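(* Let $k\ge 1$ be an integer and $n=2k$. Then $$S^2([k+1,k-1])=\sum_{\lambda\in E_4(n)}(d(\lambda)-1)[\lambda]+\sum_{\lambda\in E_2O_2'(n)}[\lambda],$$ $$A^2([k+1,k-1])=\sum_{\lambda\in O_4(n)}(d(\lambda)-1)[\lambda]+\sum_{\lambda\in E_2'O_2(n)}[\lambda].$$
   Context: For a partition $\lambda$ of $n$, $[\lambda]$ denotes the irreducible complex character of the symmetric group $S_n$ labelled by $\lambda$. For a character $\chi$ of a finite group, $S^2(\chi)(g)=\tfrac12(\chi(g)^2+\chi(g^2))$ and $A^2(\chi)(g)=\tfrac12(\chi(g)^2-\chi(g^2))$. Let $P_4(n)$ be the set of partitions of $n$ with at most four positive parts, written $\lambda=(\lambda_1\ge\lambda_2\ge\lambda_3\ge\lambda_4\ge0)$; zeros are counted as (even) parts. For $\lambda\in P_4(n)$, $d(\lambda)$ is the number of distinct values among $\lambda_1,\lambda_2,\lambda_3,\lambda_4$ (including the value $0$ if it occurs). $E_4(n)$ (resp. $O_4(n)$) is the set of $\lambda\in P_4(n)$ with all four $\lambda_i$ even (resp. all odd). $E_2O_2'(n)$ is the set of $\lambda\in P_4(n)$ with exactly two even and two odd parts, where the two odd parts are different. $E_2'O_2(n)$ is the set of $\lambda\in P_4(n)$ with exactly two even and two odd parts, where the two even parts are different. *)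

(* Defs.v *)
From mathcomp Require Import all_boot all_order all_fingroup all_algebra.
From mathcomp Require Import all_solvable all_field all_character.
Set Implicit Arguments.
Unset Strict Implicit.
Unset Printing Implicit Defensive.
Import Order.TTheory GRing.Theory Num.Theory.
Local Open Scope ring_scope.

(* The point i : 'I_n sits in row (reshape_index sh i) and column
   (reshape_offset sh i) of the standard tableau of shape sh whose rows, read
   from left to right and top to bottom, are 0, 1, ..., n - 1.  Trailing zeros
   in sh do not matter. *)
Definition row_stab (n : nat) (sh : seq nat) : {set 'S_n} :=
  [set s : 'S_n | [forall i, reshape_index sh (s i) == reshape_index sh i]].

Definition col_stab (n : nat) (sh : seq nat) : {set 'S_n} :=
  [set s : 'S_n | [forall i, reshape_offset sh (s i) == reshape_offset sh i]].

(* The Young symmetrizer, in the regular module whose basis vector number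
   (gring_index _ g) is the group element g. *)
Definition young_symm (n : nat) (sh : seq nat) :
    'rV[algC]_(gcard [set: 'S_n]%G) :=
  \sum_(p in row_stab n sh) \sum_(q in col_stab n sh)
    (-1) ^+ odd_perm q *: delta_mx 0 (gring_index [set: 'S_n]%G (p * q)%g).

(* The character [sh] of S_n: it is afforded by the Specht module, i.e. the
   right ideal of the group algebra generated by the Young symmetrizer.
   Only meaningful when sh is weakly decreasing with sum n. *)
Definition symm_char (n : nat) (sh : seq nat) : 'CF([set: 'S_n]%G) :=
  cfRepr (submod_repr
    (cyclic_mx_module (regular_repr algC [set: 'S_n]%G) (young_symm n sh))).

Section SymmetricSquare.
Variables (gT : finGroupType) (G : {group gT}).
Implicit Type chi : 'CF(G).

(* The factor (x \in G) is needed since elements of 'CF(G) vanish outside G. *)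
Fact cfun_psi2_subproof chi :
  is_class_fun <<G>>%g [ffun x => chi (x ^+ 2)%g *+ (x \in G)].
Proof.
rewrite genGid; apply: intro_class_fun => [x y Gx Gy | x /negbTE-> //].
by rewrite groupJr // -conjXg cfunJ.
Qed.
Definition cfun_psi2 chi := Cfun 0 (cfun_psi2_subproof chi).

Definition symm_square chi : 'CF(G) := 2%:R^-1 *: (chi ^+ 2 + cfun_psi2 chi).
Definition alt_square chi : 'CF(G) := 2%:R^-1 *: (chi ^+ 2 - cfun_psi2 chi).

Lemma symm_squareE chi :
  {in G, forall g, symm_square chi g = 2%:R^-1 * (chi g ^+ 2 + chi (g ^+ 2)%g)}.
Proof. by move=> g Gg; rewrite !cfunE Gg. Qed.

Lemma alt_squareE chi :
  {in G, forall g, alt_square chi g = 2%:R^-1 * (chi g ^+ 2 - chi (g ^+ 2)%g)}.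
Proof. by move=> g Gg; rewrite !cfunE Gg. Qed.
End SymmetricSquare.

(* A partition with at most four parts, padded with zeros to length four. *)
Definition parts (n : nat) (l : 4.-tuple 'I_n.+1) : seq nat :=
  [seq val i | i <- l].

Definition P4 (n : nat) : {set 4.-tuple 'I_n.+1} :=
  [set l | sorted geq (parts l) && (sumn (parts l) == n)].

Definition ndistinct (n : nat) (l : 4.-tuple 'I_n.+1) : nat :=
  size (undup (parts l)).

Definition odd_parts (n : nat) (l : 4.-tuple 'I_n.+1) : seq nat :=
  [seq m <- parts l | odd m].
Definition even_parts (n : nat) (l : 4.-tuple 'I_n.+1) : seq nat :=
  [seq m <- parts l | ~~ odd m].

Definition E4 (n : nat) : {set 4.-tuple 'I_n.+1} :=
  [set l in P4 n | all (fun m => ~~ odd m) (parts l)].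
Definition O4 (n : nat) : {set 4.-tuple 'I_n.+1} :=
  [set l in P4 n | all odd (parts l)].
Definition E2O2' (n : nat) : {set 4.-tuple 'I_n.+1} :=
  [set l in P4 n | [&& size (even_parts l) == 2, size (odd_parts l) == 2
                     & uniq (odd_parts l)]].
Definition E2'O2 (n : nat) : {set 4.-tuple 'I_n.+1} :=
  [set l in P4 n | [&& size (even_parts l) == 2, size (odd_parts l) == 2
                     & uniq (even_parts l)]].

(* Main.v *)
Require Import Defs.
From mathcomp Require Import all_boot all_order all_fingroup all_algebra.
From mathcomp Require Import all_solvable all_field all_character.
From mathcomp Require Import zify ring.
Set Implicit Arguments.
Unset Strict Implicit.
Unset Printing Implicit Defensive.
Import Order.TTheory GRing.Theory Num.Theory.
Local Open Scope ring_scope.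

(** Let g in S_n act on the functions f from the n points to r letters, and let
    p_g(x) be the sum of the monomials x^content(f) over the f that are fixed by
    g; this is the product of power sums attached to the cycle type of g.  With
    delta = (r-1, ..., 0) and a_delta the Vandermonde determinant, the value at
    g of the irreducible character of a partition lam with at most r parts is
    the coefficient of x^(lam + delta) in a_delta(x) p_g(x).  This coefficient
    is [jt_char lam g], an alternating sum of numbers of fixed functions.

    Two letters give chi = [k+1, k-1] as a constant term of p_g(t, 1/t).  Then
    chi(g)^2 is a constant term of p_g at (tu, t/u, u/t, 1/(tu)), and chi(g^2) is
    one of p_g at (t, 1/t, 1, -1), because the exchange of two letters has
    eigenvalues 1, 1, 1, -1 ([two_row_sq], [two_row_psi2]).  The two points run
    through maximal tori of the two components of O(4), and chi stands for the
    representation V_2 (x) V_2 of SL_2 x SL_2, the traceless symmetric square of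
    C^4, of character h_2 - 1.  On each torus the weight of the constant term is
    a multiple of a_delta(x) (h_2(x) - 1) divided by one or two factors y - 1/y
    ([antisym_weight_sq], [antisym_weight_psi2]).  The numerator a_delta turns
    p_g into a combination of the jt_char of the partitions in P_4(n)
    ([sum_fixes_antisym]), with coefficients that are constant terms of products
    of factors (y^a - y^(-a)) / (y - 1/y).  Such a factor contributes 1 if a > 0
    is odd and 0 if a is even, so a coefficient depends only on the parities of
    the parts and on the coincidences of consecutive parts.  Finitely many cases
    remain ([sum_tab_sq], [sum_tab_psi2]); half the sum and half the difference
    of the two expansions are the two assertions.

    That jt_char is the character of the Specht module ([symm_charE]) is proved
    by comparing norms: both class functions have norm 1 and their inner product
    is 1, so that their difference has norm 0.  The norm of jt_char counts
    matrices of naturals with given row and column sums, and a sign-reversing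
    involution leaves a single diagonal matrix ([norm_jt_char]).  The Specht
    module is simple ([specht_simple]); the stabilizer of a filling of content
    lam fixes a line in it, and the stabilizers of fillings whose content is
    another term of the determinant fix no nonzero vector ([jt_coef_rank]). *)

(** * Functions fixed by a permutation, counted by content *)

Definition fixes n (T : eqType) (g : 'S_n) (f : {ffun 'I_n -> T}) :=
  [forall i, f (g i) == f i].

Definition content n (T : eqType) (f : {ffun 'I_n -> T}) (t : T) : nat :=
  #|[pred i | f i == t]|.

Lemma fixesP n (T : eqType) (g : 'S_n) (f : {ffun 'I_n -> T}) :
  reflect (forall i, f (g i) = f i) (fixes g f).
Proof. exact: 'forall_eqP. Qed.

Lemma sum_content n (T : finType) (f : {ffun 'I_n -> T}) :
  (\sum_t content f t = n)%N.
Proof.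
rewrite -[RHS]card_ord -sum1_card (partition_big f predT) //=.
by apply: eq_bigr => t _; rewrite sum1_card; apply: eq_card.
Qed.

Lemma content_le n (T : eqType) (f : {ffun 'I_n -> T}) t : (content f t <= n)%N.
Proof. by rewrite -[leqRHS]card_ord max_card. Qed.

Lemma eq_content_perm n (T : finType) (f h : {ffun 'I_n -> T}) :
  content f =1 content h -> exists y : 'S_n, forall i, h i = f (y i).
Proof.
move=> eq_fh.
pose tf := [tuple f i | i < n]; pose th := [tuple h i | i < n].
have cnt (e : {ffun 'I_n -> T}) t : count_mem t [tuple e i | i < n] = content e t.
  by rewrite /= count_map -size_filter enumT /content cardE /enum_mem -enumT; congr size; apply: eq_filter.
have /tuple_permP [y def_y] : perm_eq th tf.
  by apply/allP => t _ /=; rewrite !cnt eq_fh.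
exists y => i.
have := congr1 (fun s => nth (h i) s i) def_y.
have <- : tnth th i = nth (h i) th i by apply: tnth_nth.
have <- : tnth [tuple tnth tf (y j) | j < n] i
        = nth (h i) [tuple tnth tf (y j) | j < n] i by apply: tnth_nth.
by rewrite !tnth_mktuple.
Qed.

Lemma content_exists n (T : finType) (N : T -> nat) :
  (\sum_t N t = n)%N -> exists f : {ffun 'I_n -> T}, content f =1 N.
Proof.
move=> sumN; pose s := flatten [seq nseq (N t) t | t <- enum T].
have sz : size s = n.
  rewrite size_flatten /shape -map_comp sumnE big_map -sumN big_enum.
  by apply: eq_bigr => t _; rewrite /= size_nseq.
case: n sumN sz => [|n] sumN sz.
  have N0 t : N t = 0%N by apply/eqP; move/eqP: sumN; rewrite sum_nat_eq0 => /forallP/(_ t).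
  by exists [ffun i : 'I_0 => False_rect _ (let: Ordinal m lt := i in notF lt)] => t; rewrite N0; apply: eq_card0 => -[].
have t0 : T by case: (s) sz.
exists [ffun i : 'I_n.+1 => nth t0 s i] => t.
transitivity (count_mem t s).
  rewrite -[s in RHS](mkseq_nth t0) sz /mkseq count_map -val_enum_ord count_map.
  rewrite -size_filter /content cardE; congr size; rewrite /enum_mem -!enumT filter_predT.
  by apply: eq_filter => i; rewrite !inE ffunE.
rewrite /s count_flatten -map_comp sumnE big_map big_enum /=.
rewrite (bigD1 t) //= big1 => [|u /negbTE ut]; rewrite count_nseq /= ?eqxx ?ut ?mul1n ?addn0 //.
Qed.

(** The functions with a given content N form one orbit of S_n, and the orders
    of the stabilizers of the points of an orbit add up to the order of the
    group: each N contributes n! phi(N). *)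
Lemma sum_fixes_content n (T : finType) (V : nmodType) (phi : {ffun T -> nat} -> V) :
  \sum_(g : 'S_n) \sum_(f : {ffun 'I_n -> T} | fixes g f) phi (finfun (content f)) =
  (\sum_(N : {ffun T -> 'I_n.+1} | \sum_t (N t : nat) == n)
      phi [ffun t => N t : nat]) *+ n`!.
Proof.
pose ct (f : {ffun 'I_n -> T}) : {ffun T -> 'I_n.+1} := [ffun t => inord (content f t)].
have ctE f t : ct f t = content f t :> nat.
  by rewrite ffunE inordK // ltnS content_le.
rewrite (exchange_big_dep predT) //=.
rewrite (partition_big ct (fun N : {ffun T -> 'I_n.+1} => \sum_t (N t : nat) == n)%N) /=; last first.
  by move=> f _; rewrite -[eqbRHS](sum_content f); apply/eqP/eq_bigr => t _; apply: ctE.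
rewrite -sumrMnl; apply: eq_bigr => N /eqP sumN.
have [f0 f0E] := content_exists sumN.
transitivity (\sum_(f | ct f == N) phi [ffun t => N t : nat] *+ #|[pred g | fixes g f]|).
  apply: eq_bigr => f /eqP fN; rewrite sumr_const; congr (phi _ *+ _).
  by apply/ffunP => t; rewrite !ffunE -fN ctE.
rewrite sumrMnr; congr (_ *+ _).
rewrite -card_Sn -sum1_card.
(* The fibre of y |-> f0 o y over f is a coset of the stabilizer of f. *)
pose act (y : 'S_n) : {ffun 'I_n -> T} := [ffun i => f0 (y i)].
have act_ct y : ct (act y) = N.
  apply/ffunP => t; apply: val_inj; rewrite /= ctE -f0E.
  rewrite /content -(card_imset _ (@perm_inj _ y)); apply: eq_card => i.
  rewrite !inE; apply/imsetP/idP => [[j] |fi].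
    by rewrite !inE ffunE => fj ->.
  by exists ((y^-1)%g i); rewrite ?inE ?ffunE permKV.
rewrite [RHS](partition_big act (fun f => ct f == N)) /=; last first.
  by move=> y _; rewrite act_ct.
apply: eq_bigr => f /eqP fN.
have [|y fE] := @eq_content_perm n T f0 f.
  by move=> t; rewrite f0E -ctE fN.
transitivity #|[set z | act z == f]|; last by rewrite -sum1dep_card.
rewrite -[LHS](card_imset _ (mulIg y)); apply: eq_card => z.
rewrite inE; apply/imsetP/eqP => [[g] | fz].
  move=> /fixesP gf ->; apply/ffunP => i.
  by rewrite ffunE permM -fE gf.
exists (z * y^-1)%g; last by rewrite mulgKV.
apply/fixesP => i; rewrite permM !fE permKV.
by rewrite -fE -fz ffunE.
Qed.

Lemma sum_fixes_relabel n (V : nmodType) (g : 'S_n) (T1 T2 : finType)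
    (phi : T1 -> T2) (phi' : T2 -> T1) (H : (T2 -> nat) -> V) :
  (forall x y, x =1 y -> H x = H y) -> cancel phi phi' -> cancel phi' phi ->
  \sum_(f : {ffun 'I_n -> T2} | fixes g f) H (content f) =
  \sum_(f : {ffun 'I_n -> T1} | fixes g f) H (fun t => content f (phi' t)).
Proof.
move=> eqH phiK phiK'.
pose tr (f : {ffun 'I_n -> T1}) : {ffun 'I_n -> T2} := [ffun i => phi (f i)].
pose tr' (f : {ffun 'I_n -> T2}) : {ffun 'I_n -> T1} := [ffun i => phi' (f i)].
have trK f : tr' (tr f) = f by apply/ffunP => i; rewrite !ffunE phiK.
have trK' f : tr (tr' f) = f by apply/ffunP => i; rewrite !ffunE phiK'.
rewrite (reindex_onto tr tr') => [|f _]; last exact: trK'.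
apply: eq_big => [f|f _].
  rewrite trK eqxx andbT; apply/fixesP/fixesP => fg i; last by rewrite !ffunE fg.
  by have /(congr1 phi') := fg i; rewrite !ffunE !phiK.
apply: eqH => t; apply: eq_card => i; rewrite !inE ffunE.
by apply/eqP/eqP => [<-|->]; rewrite ?phiK ?phiK'.
Qed.

Lemma sum_fixes_pair n (V : nmodType) (g : 'S_n) (T1 T2 : finType)
    (H : (T1 -> nat) -> (T2 -> nat) -> V) :
  (forall x x' y y', x =1 x' -> y =1 y' -> H x y = H x' y') ->
  \sum_(f : {ffun 'I_n -> T1} | fixes g f) \sum_(h : {ffun 'I_n -> T2} | fixes g h)
     H (content f) (content h) =
  \sum_(F : {ffun 'I_n -> T1 * T2} | fixes g F)
     H (fun t => \sum_s content F (t, s))%N (fun s => \sum_t content F (t, s))%N.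
Proof.
move=> eqH; rewrite pair_big /=.
pose pr (p : {ffun 'I_n -> T1} * {ffun 'I_n -> T2}) : {ffun 'I_n -> T1 * T2} :=
  [ffun i => (p.1 i, p.2 i)].
pose pr' (F : {ffun 'I_n -> T1 * T2}) : {ffun 'I_n -> T1} * {ffun 'I_n -> T2} :=
  ([ffun i => (F i).1], [ffun i => (F i).2]).
have prK : cancel pr pr'.
  by move=> [f1 f2]; congr (_, _); apply/ffunP => i; rewrite !ffunE.
have prK' : cancel pr' pr by move=> F; apply/ffunP => i; rewrite !ffunE /=; case: (F i).
rewrite [RHS](reindex pr); last by exists pr' => ? _; [apply: prK | apply: prK'].
apply: eq_big => [[f1 f2] /=|[f1 f2] _ /=].
  apply/andP/fixesP => [[/fixesP f1g /fixesP f2g] i|fg].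
    by rewrite !ffunE f1g f2g.
  by split; apply/fixesP => i; have := fg i; rewrite !ffunE => -[].
apply: eqH => t.
  rewrite /content -sum1_card (partition_big f2 predT) //=; apply: eq_bigr => s _.
  by rewrite -sum1_card; apply: eq_bigl => k; rewrite !inE ffunE xpair_eqE.
rewrite /content -sum1_card (partition_big f1 predT) //=; apply: eq_bigr => s _.
by rewrite -sum1_card; apply: eq_bigl => k; rewrite !inE ffunE xpair_eqE andbC.
Qed.

(** * Jacobi-Trudi characters *)

(** lam + delta, the strictly decreasing sequence attached to a partition lam. *)
Definition beta r (lam : 'I_r -> nat) (i : 'I_r) : nat := (lam i + rev_ord i)%N.

(** The coefficient of x in the alternant whose exponent is l: the sign of the
    permutation that rearranges l into x, and 0 if there is none, provided that
    the entries of l are distinct. *)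
Definition rearr_sign r (l x : 'I_r -> nat) : int :=
  \sum_(w : 'S_r) (-1) ^+ odd_perm w * [forall i, x i == l (w i)]%:R.

(** The coefficient of the permutation character of content a in the expansion
    of the determinant det (h_(lam_i - i + j)). *)
Definition jt_coef r (lam a : 'I_r -> nat) : int :=
  \sum_(w : 'S_r) (-1) ^+ odd_perm w
    * [forall i, (a i + rev_ord (w i))%N == beta lam i]%:R.

Definition jt_char n r (lam : 'I_r -> nat) (g : 'S_n) : int :=
  \sum_(f : {ffun 'I_n -> 'I_r} | fixes g f) jt_coef lam (content f).

Lemma eq_rearr_sign r (l x y : 'I_r -> nat) : x =1 y -> rearr_sign l x = rearr_sign l y.
Proof.
move=> xy; apply: eq_bigr => w _; congr (_ * _%:R); congr (nat_of_bool _).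
by apply: eq_forallb => i; rewrite xy.
Qed.

Lemma eq_jt_coef r (l x y : 'I_r -> nat) : x =1 y -> jt_coef l x = jt_coef l y.
Proof.
move=> xy; apply: eq_bigr => w _; congr (_ * _%:R); congr (nat_of_bool _).
by apply: eq_forallb => i; rewrite xy.
Qed.

Lemma rearr_sign_comp r (l x : 'I_r -> nat) (t : 'S_r) :
  rearr_sign l (x \o t) = (-1) ^+ odd_perm t * rearr_sign l x.
Proof.
rewrite /rearr_sign (reindex_inj (mulgI t)) mulr_sumr; apply: eq_bigr => w _.
rewrite odd_permM signr_addb mulrA; congr (_ * _%:R); congr (nat_of_bool _).
apply/forallP/forallP => H i; first by have := H ((t^-1)%g i); rewrite /= permM permKV.
by rewrite /= permM.
Qed.

(** Permuting the letters permutes the fixed functions. *)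
Lemma sum_fixes_perm n r (V : nmodType) (g : 'S_n) (w : 'S_r)
    (H : ('I_r -> nat) -> V) :
  (forall x y, x =1 y -> H x = H y) ->
  \sum_(f : {ffun 'I_n -> 'I_r} | fixes g f) H (content f) =
  \sum_(f : {ffun 'I_n -> 'I_r} | fixes g f) H (fun i => content f (w i)).
Proof. by move=> eqH; apply: sum_fixes_relabel (permKV w) (permK w). Qed.

(** Letting the permutation act on lam + delta instead of on delta amounts to
    renaming the letters, which preserves the set of fixed functions.  In this
    form the summand is antisymmetric in content + delta. *)
Lemma jt_charE n r (lam : 'I_r -> nat) (g : 'S_n) :
  jt_char lam g = \sum_(f : {ffun 'I_n -> 'I_r} | fixes g f)
                 rearr_sign (beta lam) (beta (content f)).
Proof.
rewrite /jt_char /jt_coef /rearr_sign exchange_big [RHS]exchange_big /=.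
rewrite (reindex_inj invg_inj); apply: eq_bigr => w _ /=.
rewrite odd_permV; transitivity (\sum_(f : {ffun 'I_n -> 'I_r} | fixes g f)
  (-1) ^+ odd_perm w * ([forall i,
     (content f ((w^-1)%g i) + rev_ord ((w^-1)%g i))%N == beta lam i]%:R : int)).
  apply: (@sum_fixes_perm _ _ _ _ (w^-1)%g (fun a => (-1) ^+ odd_perm w * ([forall i,
     (a i + rev_ord ((w^-1)%g i))%N == beta lam i]%:R : int))).
  move=> x y xy; congr (_ * _%:R); congr (nat_of_bool _).
  by apply: eq_forallb => i; rewrite xy.
apply: eq_bigr => f _; congr (_ * _%:R); congr (nat_of_bool _).
apply/forallP/forallP => H i; first by have := H (w i); rewrite permK.
by have := H ((w^-1)%g i); rewrite permKV.
Qed.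

(** A matrix N is to be read as the content of a pair of fillings, with row sums
    the content of the first and column sums the content of the second.  The sum
    over all N of a function that is antisymmetric in row_sums N + delta and
    depends otherwise only on col_sums N is carried by the upper triangular N. *)
Section Matrices.
Variables (n r : nat).
Local Notation mat := {ffun 'I_r * 'I_r -> 'I_n.+1}.
Implicit Types (N M : {ffun 'I_r * 'I_r -> 'I_n.+1}) (i j k a b : 'I_r).

Definition row_sums N (i : 'I_r) := (\sum_j (N (i, j) : nat))%N.
Definition col_sums N (j : 'I_r) := (\sum_i (N (i, j) : nat))%N.

Definition below_diag N (x : 'I_r * 'I_r) := (x.2 < x.1)%N && (0 < N x)%N.

(** Orders the cells by columns from left to right, and upwards in a column. *)
Definition cell_rank (x : 'I_r * 'I_r) := (x.2 * r + rev_ord x.1)%N.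
Definition first_below N x :=
  below_diag N x && [forall y, below_diag N y ==> (cell_rank x <= cell_rank y)%N].

Lemma cell_rank_inj : injective cell_rank.
Proof.
move=> [i j] [k j'] /= eq_c; have := congr1 (fun m => m %% r)%N eq_c.
have := congr1 (fun m => m %/ r)%N eq_c; rewrite /cell_rank /=.
have r0 : (0 < r)%N by apply: leq_trans (ltn_ord i).
rewrite !divnMDl // !modnMDl !divn_small ?modn_small ?addn0; try lia.
move=> jj ii; congr (_, _); apply: val_inj => //=.
have := ltn_ord i; have := ltn_ord k; lia.
Qed.

(** M is obtained from N by exchanging the consecutive rows k and i = k + 1 and
    then moving one unit from (k, j) down to (i, j); as delta_k = delta_i + 1, the
    entries k and i of row sums plus delta are exchanged.  The relational form,
    free of subtraction, makes the symmetry in N and M visible. *)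
Definition twin (k i j : 'I_r) N M := forall a b,
  (M (a, b) + ((b == j) && (a == k)) = N (tperm k i a, b) + ((b == j) && (a == i)))%N.

Lemma twin_sym k i j N M : twin k i j N M -> twin k i j M N.
Proof.
move=> tw a b; have := tw (tperm k i a) b.
rewrite tpermK (can2_eq (tpermK k i) (tpermK k i)) tpermL.
by rewrite (can2_eq (tpermK k i) (tpermK k i)) tpermR => ->.
Qed.

Lemma twin_inj k i j N M M' : twin k i j N M -> twin k i j N M' -> M = M'.
Proof.
move=> tw tw'; apply/ffunP => -[a b]; apply: val_inj.
by have := tw a b; rewrite -tw' => /addIn.
Qed.

Lemma twin_row_sums k i j N M : (k.+1 = i)%N -> twin k i j N M ->
  beta (row_sums M) =1 beta (row_sums N) \o tperm k i.
Proof.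
move=> ki tw a; rewrite /beta /=.
have : (row_sums M a + (a == k) = row_sums N (tperm k i a) + (a == i))%N.
  have sum1 (c : bool) : (\sum_b ((b == j) && c) = c)%N.
    rewrite (bigD1 j) //= eqxx big1 ?addn0 // => b /negbTE -> //.
  rewrite /row_sums -[X in (_ + X = _)%N](sum1 (a == k)) -[X in (_ = _ + X)%N](sum1 (a == i)).
  by rewrite -!big_split; apply: eq_bigr => b _; apply: tw.
have := ltn_ord i; have := ltn_ord a; case: tpermP => [->|->|/eqP/negbTE -> /eqP/negbTE ->].
- by rewrite eqxx; case: eqP => [/(congr1 val) /=|]; lia.
- by rewrite eqxx; case: eqP => [/(congr1 val) /=|]; lia.
- lia.
Qed.

Lemma twin_col_sums k i j N M : twin k i j N M -> col_sums M =1 col_sums N.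
Proof.
move=> tw b.
have sum1 (a0 : 'I_r) (c : bool) : (\sum_a (c && (a == a0)) = c)%N.
  by rewrite (bigD1 a0) //= eqxx andbT big1 ?addn0 // => a /negbTE ->; rewrite andbF.
apply: (@addIn (b == j)); rewrite -{1}(sum1 k (b == j)) -{1}(sum1 i (b == j)).
rewrite /col_sums [X in (_ = X + _)%N](reindex_inj (@perm_inj _ (tperm k i))).
by rewrite -!big_split; apply: eq_bigr => a _; apply: tw.
Qed.

Lemma sum_col_sums N : (\sum_t (N t : nat) = \sum_j col_sums N j)%N.
Proof. by rewrite /col_sums exchange_big pair_big /=; apply: eq_bigr => -[]. Qed.

Lemma sum_row_sums N : (\sum_t (N t : nat) = \sum_i row_sums N i)%N.
Proof. by rewrite /row_sums pair_big /=; apply: eq_bigr => -[]. Qed.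

(** The cells before (i, j) in the order of [cell_rank] keep the value 0: the
    columns on the left of j vanish in both exchanged rows of N, since k >= j. *)
Lemma twin_first_below k i j N M : (k.+1 = i)%N -> (j < i)%N -> twin k i j N M ->
  first_below N (i, j) -> first_below M (i, j).
Proof.
move=> ki ji tw /andP [_ /forallP minN]; apply/andP; split.
  rewrite /below_diag /= ji /=; have := tw i j; rewrite eqxx /= eqxx tpermR.
  by case: eqP => [/(congr1 val) /=|_]; lia.
apply/forallP => -[a b]; apply/implyP => /andP [/= ba Mab].
rewrite /cell_rank /=; case: (ltngtP b j) => bj; last 1 first.
- rewrite (val_inj bj) leq_add2l; have e_bj := val_inj bj; rewrite {}e_bj in ba Mab bj *.
  case: (leqP a i) => ai; first lia.
  have := implyP (minN (a, j)); rewrite /below_diag /cell_rank /= ba /=.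
  have := tw a j; rewrite eqxx /= tpermD; try by apply/eqP => e; move: ai; rewrite -e; lia.
  by case: eqP => [e|_]; [move: ai; rewrite e; lia|];
     case: eqP => [e|_]; [move: ai; rewrite e; lia|]; lia.
- have := implyP (minN (tperm k i a, b)); rewrite /below_diag /cell_rank /=.
  have := tw a b; have /negbTE -> : b != j by apply/eqP => e; rewrite e ltnn in bj.
  rewrite /= !addn0 => <-; rewrite Mab andbT.
  have lta : (b < tperm k i a)%N by case: tpermP => //; lia.
  move=> /(_ lta); have := ltn_ord a; have := ltn_ord (tperm k i a); nia.
- have := ltn_ord a; have := ltn_ord i; nia.
Qed.

Lemma twin_exists k i j N : (k.+1 = i)%N -> (\sum_t (N t : nat) = n)%N ->
  (0 < N (i, j))%N -> exists M, twin k i j N M.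
Proof.
move=> ki sumN Nij.
have kneq : k != i by apply/eqP => e; move: ki; rewrite e; lia.
have Nle a b : (N (tperm k i a, b) + ((b == j) && (a == i)) <= n)%N.
  have [->|bj] := eqVneq b j; last first.
    by rewrite addn0 -ltnS.
  have [->|ai] := eqVneq a i; last by rewrite addn0 -ltnS.
  rewrite tpermR /= -[leqRHS]sumN (bigD1 (k, j)) //= (bigD1 (i, j)) /=; first lia.
  by rewrite xpair_eqE eqxx andbT eq_sym.
exists [ffun x => inord (N (tperm k i x.1, x.2) + ((x.2 == j) && (x.1 == i))
                     - ((x.2 == j) && (x.1 == k)))%N] => a b.
rewrite ffunE /= inordK; last by rewrite ltnS (leq_trans (leq_subr _ _)).
rewrite subnK //; have [-> /=|//] := eqVneq b j.
have [->|//] := eqVneq a k; rewrite tpermL.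
exact: leq_trans Nij (leq_addr _ _).
Qed.

(** Passing to the twin is a sign-reversing involution of the set of matrices
    whose first entry below the diagonal is x. *)
Lemma sum_first_below (F : mat -> int) x :
  (forall N M (t : 'S_r), odd_perm t -> beta (row_sums M) =1 beta (row_sums N) \o t ->
     col_sums M =1 col_sums N -> F M = - F N) ->
  \sum_(N : mat | (\sum_t (N t : nat) == n)%N && first_below N x) F N = 0.
Proof.
case: x => i j HF; have [ji|ij] := ltnP j i; last first.
  by rewrite big_pred0 // => N; rewrite /first_below /below_diag /= ltnNge ij /= andbF.
have kP : (i.-1 < r)%N by have := ltn_ord i; lia.
pose k := Ordinal kP; have ki : (k.+1 = i)%N by rewrite /=; lia.
pose twb N M := [forall a, forall b,
  (M (a, b) + ((b == j) && (a == k)) == N (tperm k i a, b) + ((b == j) && (a == i)))%N].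
have twbP N M : reflect (twin k i j N M) (twb N M).
  apply: (iffP forallP) => [H a b|H a]; first by apply/eqP/(forallP (H a)).
  by apply/forallP => b; apply/eqP.
pose s N := odflt N [pick M | twb N M].
pose P N := ((\sum_t (N t : nat) == n)%N && first_below N (i, j)).
have sP N : P N -> twin k i j N (s N).
  case/andP => /eqP sumN /andP [/andP [_ Nij] _].
  rewrite /s; case: pickP => [M /twbP //|noM].
  by have [M /twbP] := twin_exists ki sumN Nij; rewrite noM.
have PP N : P N -> P (s N).
  move=> PN; have tw := sP _ PN; case/andP: PN => sumN lowN.
  rewrite /P (twin_first_below ki ji tw lowN) andbT sum_col_sums.
  by rewrite (eq_bigr _ (fun b _ => twin_col_sums tw b)) -sum_col_sums.
have sK N : P N -> s (s N) = N.
  by move=> PN; apply: (twin_inj (sP _ (PP _ PN)) (twin_sym (sP _ PN))).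
set S := \sum_(_ | _) _; suff SS : S + S = 0 by lia.
rewrite {1}/S (reindex_onto s s) /=; last exact: sK.
rewrite (eq_bigl P) => [|N]; last first.
  apply/andP/idP => [[PsN /eqP <-]|PN]; first exact: PP.
  by rewrite sK ?eqxx //; split=> //; exact: PP.
rewrite -big_split /= big1 // => N PN; have tw := sP _ PN.
rewrite (HF N (s N) (tperm k i)) ?addNr //.
- rewrite odd_tperm; apply/eqP => e; move: ki; rewrite e; lia.
- exact: twin_row_sums.
- exact: twin_col_sums.
Qed.

Lemma sum_upper_matrices (F : mat -> int) :
  (forall N M (t : 'S_r), odd_perm t -> beta (row_sums M) =1 beta (row_sums N) \o t ->
     col_sums M =1 col_sums N -> F M = - F N) ->
  \sum_(N : mat | (\sum_t (N t : nat) == n)%N) F N =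
  \sum_(N : mat | (\sum_t (N t : nat) == n)%N && [forall x, ~~ below_diag N x]) F N.
Proof.
move=> HF; rewrite (bigID (fun N => [forall x, ~~ below_diag N x])) /=.
rewrite [X in _ + X](partition_big (fun N => [pick x | first_below N x]) predT) //=.
rewrite [X in _ + X]big1 ?addr0 // => -[x|] _; last first.
  rewrite big_pred0 // => N; apply/negbTE/negP => /andP [/andP [_ badN]].
  case: pickP => // noN _; case/forallPn: badN => x; rewrite negbK => lx.
  case: (arg_minnP cell_rank lx) => y ly miny; have := noN y.
  rewrite /first_below ly /= => /negP; case; apply/forallP => z; apply/implyP/miny.
rewrite -[RHS](sum_first_below x HF); apply: eq_bigl => N; rewrite -andbA.
congr (_ && _); case: pickP => [y fy|noN]; last first.
  by rewrite noN andbF.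
apply/andP/idP => [[_ /eqP [<-]] //|fx].
have lowx : below_diag N x by case/andP: fx.
split; first by apply/forallPn; exists x; rewrite negbK.
apply/eqP; congr Some; apply: cell_rank_inj; apply/eqP; rewrite eqn_leq.
case/andP: fx => _ /forallP/(_ y)/implyP fx; case/andP: fy => ly /forallP/(_ x)/implyP fy.
by rewrite fx ?fy.
Qed.
End Matrices.

(** * The norm of a Jacobi-Trudi character *)

Lemma sum_rev_ord r (y : 'I_r -> nat) :
  (\sum_i rev_ord i * y i = \sum_(i < r) \sum_(k < r | i < k) y i)%N.
Proof.
apply: eq_bigr => i _; rewrite sum_nat_const; congr (_ * _)%N => /=.
have := cardC [pred k : 'I_r | (k <= i)%N]; rewrite card_ord.
have -> : #|[pred k : 'I_r | (k <= i)%N]| = i.+1.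
  by rewrite -sum1_card -(big_ord_widen_leq _ predT (fun=> 1%N)) ?sum1_card ?card_ord.
move=> cr; rewrite -[X in (X - _)%N]cr addKn; apply: eq_card => k; by rewrite unfold_in /= -ltnNge.
Qed.

(** Both sums run over the unordered pairs of indices, which w permutes. *)
Lemma sum_max_perm r (y : 'I_r -> nat) (w : 'S_r) :
  (\sum_(i < r) \sum_(k < r | i < k) maxn (y (w i)) (y (w k)) =
   \sum_(i < r) \sum_(k < r | i < k) maxn (y i) (y k))%N.
Proof.
have dbl (z : 'I_r -> nat) : ((\sum_(i < r) \sum_(k < r | i < k) maxn (z i) (z k)).*2 =
    \sum_(i < r) \sum_(k < r | k != i) maxn (z i) (z k))%N.
  rewrite -addnn {2}(exchange_big_dep predT) //= -big_split /=.
  apply: eq_bigr => i _; rewrite [RHS](bigID (fun k : 'I_r => (i < k)%N)) /=.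
  congr (_ + _)%N; apply: eq_big => k.
  - by rewrite neq_ltn orbC andbC; case: (ltngtP i k).
  - by [].
  - by rewrite neq_ltn -leqNgt; case: (ltngtP i k).
  - by rewrite maxnC.
apply: double_inj; rewrite !dbl [RHS](reindex_inj (@perm_inj _ w)) /=.
apply: eq_bigr => i _; rewrite [RHS](reindex_inj (@perm_inj _ w)) /=.
by apply: eq_bigl => k; rewrite (inj_eq perm_inj).
Qed.

(** Each of the pairs i < k contributes y (w i) on the left-hand side, which is at
    most max (y (w i), y (w k)); for decreasing y this bound is attained by the
    identity, pair by pair. *)
Lemma rearrangement r (y : 'I_r -> nat) (w : 'S_r) :
  (forall i k : 'I_r, (i < k)%N -> (y k <= y i)%N) ->
  (\sum_i rev_ord i * y (w i) <= \sum_i rev_ord i * y i)%N.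
Proof.
move=> decy; rewrite sum_rev_ord [leqRHS]sum_rev_ord.
have <- : (\sum_(i < r) \sum_(k < r | i < k) maxn (y i) (y k) = \sum_(i < r) \sum_(k < r | i < k) y i)%N.
  by apply: eq_bigr => i _; apply: eq_bigr => k /decy /maxn_idPl.
rewrite -(sum_max_perm y w); apply: leq_sum => i _; apply: leq_sum => k _.
exact: leq_maxl.
Qed.

Lemma sum_mul_perm r (y : 'I_r -> nat) (w : 'S_r) : injective y ->
  (\sum_i y i * y (w i) <= \sum_i y i * y i ?= iff (w == 1%g))%N.
Proof.
move=> y_inj.
have E : (\sum_i (y i ^ 2 + y (w i) ^ 2) = 2 * \sum_i y i * y i)%N.
  have Ew : (\sum_i y (w i) ^ 2 = \sum_i y i ^ 2)%N.
    by rewrite [RHS](reindex_inj (@perm_inj _ w)).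
  rewrite big_split /= Ew.
  by rewrite mul2n -addnn; congr (_ + _)%N; apply: eq_bigr => i _; rewrite mulnn.
rewrite -(mono_leqif (fun a b => leq_pmul2l (isT : 0 < 2)%N : (2 * a <= 2 * b)%N = (a <= b)%N)) -E big_distrr /=.
have -> : (w == 1%g) = [forall (i | true), y i == y (w i)].
  apply/eqP/forallP => [-> i|H]; first by rewrite perm1 eqxx.
  by apply/permP => i; rewrite perm1; apply/esym/y_inj/eqP; exact: (H i).
by apply: leqif_sum => i _; apply: nat_Cauchy.
Qed.

Section JacobiTrudiNorm.
Variables (n r : nat) (lam : 'I_r -> nat).
Hypothesis lam_dec : forall i k : 'I_r, (i <= k)%N -> (lam k <= lam i)%N.
Hypothesis sum_lam : (\sum_i lam i = n)%N.

Lemma beta_dec (i k : 'I_r) : (i < k)%N -> (beta lam k < beta lam i)%N.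
Proof.
by move=> ik; have := lam_dec (ltnW ik); rewrite /beta /=; have := ltn_ord k; lia.
Qed.

Lemma beta_inj : injective (beta lam).
Proof.
move=> i k; case: (ltngtP i k) => [/beta_dec|/beta_dec|/val_inj //]; lia.
Qed.

(** Weighing the rows and the columns of N by delta, upper triangularity gives
      sum delta_j col_j <= sum delta_i row_i.
    Inserting the two sequences of sums, the rearrangement inequality bounds the
    right-hand side from above, and 2 x y <= x^2 + y^2 bounds the left-hand side
    from below by the same number.  Hence all are equalities: v = 1 and N is
    diagonal, and then w = 1. *)
Lemma upper_matrix_unique (N : {ffun 'I_r * 'I_r -> 'I_n.+1}) (w v : 'S_r) :
  [forall x, ~~ below_diag N x] -> 
  (forall i, beta (row_sums N) i = beta lam (w i)) ->
  (forall j, col_sums N j + rev_ord (v j) = beta lam j)%N ->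
  [/\ w = 1%g, v = 1%g & forall i j, N (i, j) = (if i == j then lam i else 0%N) :> nat].
Proof.
move=> /forallP up rowE colE.
have upN (i j : 'I_r) : (j < i)%N -> N (i, j) = 0%N :> nat.
  by move=> ji; have := up (i, j); rewrite /below_diag /= ji -eqn0Ngt => /eqP.
have Nle (i j : 'I_r) : (rev_ord j * N (i, j) <= rev_ord i * N (i, j) ?= iff ((i == j) || (N (i, j) == 0%N :> nat)))%N.
  have [ji|ij] := ltnP j i.
    by rewrite upN // !muln0 eqxx orbT; split.
  split; first by rewrite leq_mul2r /=; lia.
  rewrite eqn_mul2r orbC /=; congr (_ || _); rewrite -val_eqE /=; have jr := ltn_ord j; have ir := ltn_ord i.
  by clear -ir jr; case: eqP; case: eqP => //; lia.
have rc : (\sum_i \sum_j rev_ord j * N (i, j) <= \sum_i \sum_j rev_ord i * N (i, j)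
     ?= iff [forall i, [forall j, (i == j) || (N (i, j) == 0%N :> nat)]])%N.
  by apply: leqif_sum => i _; apply: leqif_sum => j _.
have rE : (\sum_i \sum_j rev_ord i * N (i, j) + \sum_(i < r) (rev_ord i * rev_ord i) =
           \sum_i rev_ord i * beta lam (w i))%N.
  rewrite -big_split; apply: eq_bigr => i _.
  by rewrite -rowE /beta /row_sums mulnDr big_distrr.
have cE : (\sum_i \sum_j rev_ord j * N (i, j) + \sum_j (rev_ord j * rev_ord (v j)) =
           \sum_j rev_ord j * beta lam j)%N.
  rewrite exchange_big -big_split; apply: eq_bigr => j _.
  by rewrite -colE /col_sums mulnDr big_distrr.
have [sq sqE] := @sum_mul_perm r (fun i => rev_ord i) v
   (fun i k e => rev_ord_inj (val_inj e)).
have ra := @rearrangement r (beta lam) w (fun i k ik => ltnW (beta_dec ik)).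
have squeeze (C R d W dv L : nat) : (C <= R -> R + d = W -> C + dv = L ->
  dv <= d -> W <= L -> dv = d /\ C = R)%N by lia.
have [dvE CR] := squeeze _ _ _ _ _ _ rc.1 rE cE sq ra.
have v1 : v = 1%g by apply/eqP; rewrite -sqE; apply/eqP.
have diag (i j : 'I_r) : i != j -> N (i, j) = 0%N :> nat.
  case: rc => rc rcE; have : [forall i, [forall j, (i == j) || (N (i, j) == 0%N :> nat)]].
    by rewrite -rcE; apply/eqP.
  by move=> /forallP/(_ i)/forallP/(_ j)/orP [->|/eqP].
have NE (i j : 'I_r) : N (i, j) = (if i == j then lam i else 0%N) :> nat.
  case: eqVneq => [->|/diag //]; have := colE j; rewrite v1 perm1 /beta => /addIn <-.
  by rewrite /col_sums (bigD1 j) //= big1 ?addn0 // => k /diag.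
split=> //; apply/permP => i; rewrite perm1; apply/esym/beta_inj; rewrite -rowE.
congr (_ + _)%N; rewrite /row_sums (bigD1 i) //= NE eqxx big1 ?addn0 // => k ki.
by rewrite NE eq_sym (negbTE ki).
Qed.

Lemma sum_upper_matrices_sign :
  \sum_(N : {ffun 'I_r * 'I_r -> 'I_n.+1} | (\sum_t (N t : nat) == n)%N)
     rearr_sign (beta lam) (beta (row_sums N)) * jt_coef lam (col_sums N) = 1.
Proof.
rewrite sum_upper_matrices; last first.
  move=> N M t ot rE cE; rewrite (eq_rearr_sign _ rE) (eq_jt_coef _ cE) rearr_sign_comp ot.
  by rewrite expr1 mulN1r mulNr.
pose D : {ffun 'I_r * 'I_r -> 'I_n.+1} :=
  [ffun x => inord (if x.1 == x.2 then lam x.1 else 0%N)].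
have DE (i j : 'I_r) : D (i, j) = (if i == j then lam i else 0%N) :> nat.
  rewrite ffunE /= inordK //; case: eqP => // _.
  by rewrite ltnS -sum_lam (bigD1 i) //= leq_addr.
have rowD i : row_sums D i = lam i.
  rewrite /row_sums (bigD1 i) //= DE eqxx big1 ?addn0 // => k ki.
  by rewrite DE eq_sym (negbTE ki).
have colD i : col_sums D i = lam i.
  rewrite /col_sums (bigD1 i) //= DE eqxx big1 ?addn0 // => k ki.
  by rewrite DE (negbTE ki).
have upD : [forall x, ~~ below_diag D x].
  apply/forallP => -[i j]; rewrite /below_diag DE /=; case: eqP => [->|_]; rewrite ?ltnn ?andbF //.
rewrite (bigD1 D) /=; last first.
  by rewrite upD andbT sum_row_sums (eq_bigr _ (fun i _ => rowD i)) sum_lam.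
rewrite big1 ?addr0 => [|N /andP [/andP [_ upN] ND]]; last first.
  rewrite /rearr_sign /jt_coef mulr_suml big1 // => w _; rewrite mulr_sumr big1 // => v _.
  case: forallP => [rowE|_]; last by rewrite mulr0 mul0r.
  case: forallP => [colE|_]; last by rewrite !mulr0.
  case/eqP: ND; have [_ _ NE] := upper_matrix_unique upN (fun i => eqP (rowE i)) (fun i => eqP (colE i)).
  by apply/ffunP => -[i j]; apply: val_inj; rewrite /= NE DE.
have rowD1 i : beta (row_sums D) i = beta lam ((1%g : 'S_r) i).
  by rewrite perm1 /beta rowD.
have colD1 i : (col_sums D i + rev_ord ((1%g : 'S_r) i))%N = beta lam i.
  by rewrite perm1 /beta colD.
have -> : rearr_sign (beta lam) (beta (row_sums D)) = 1.
  rewrite /rearr_sign (bigD1 1%g) //= odd_perm1 expr0 mul1r big1 ?addr0 => [|w w1].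
    by case: forallP => // [[]] i; rewrite rowD1.
  case: forallP => [rowE|_]; last by rewrite mulr0.
  by case/eqP: w1; case: (upper_matrix_unique upD (fun i => eqP (rowE i)) colD1).
have -> : jt_coef lam (col_sums D) = 1.
  rewrite /jt_coef (bigD1 1%g) //= odd_perm1 expr0 mul1r big1 ?addr0 => [|v v1].
    by case: forallP => // [[]] i; rewrite colD1.
  case: forallP => [colE|_]; last by rewrite mulr0.
  by case/eqP: v1; case: (upper_matrix_unique upD rowD1 (fun i => eqP (colE i))).
by rewrite mulr1.
Qed.

(** One factor is written with jt_charE and the other one by definition: the
    average over g becomes a sum over matrices N, antisymmetric in the row sums,
    and only the diagonal matrix of lam survives. *)
Lemma norm_jt_char : \sum_(g : 'S_n) jt_char lam g ^+ 2 = n`!%:R.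
Proof.
pose H (x y : 'I_r -> nat) := rearr_sign (beta lam) (beta x) * jt_coef lam y.
have eqH x x' y y' : x =1 x' -> y =1 y' -> H x y = H x' y'.
  by move=> xx yy; congr (_ * _); [apply: eq_rearr_sign => i; rewrite /beta xx | apply: eq_jt_coef].
pose phi (c : {ffun 'I_r * 'I_r -> nat}) : int :=
  H (fun i => \sum_j c (i, j))%N (fun j => \sum_i c (i, j))%N.
have phiE (c : 'I_r * 'I_r -> nat) :
    H (fun i => \sum_j c (i, j))%N (fun j => \sum_i c (i, j))%N = phi (finfun c).
  by apply: eqH => i; apply: eq_bigr => j _; rewrite ffunE.
transitivity (\sum_(g : 'S_n) \sum_(F : {ffun 'I_n -> 'I_r * 'I_r} | fixes g F)
    phi (finfun (content F))).
  apply: eq_bigr => g _; rewrite expr2 {1}jt_charE /jt_char mulr_suml.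
  under eq_bigr do rewrite mulr_sumr.
  by rewrite (sum_fixes_pair _ eqH); apply: eq_bigr => F _; apply: phiE.
rewrite sum_fixes_content; congr (_ *+ _); rewrite -[RHS]sum_upper_matrices_sign.
by apply: eq_bigr => N _; rewrite -phiE.
Qed.
End JacobiTrudiNorm.

(** * Fillings that are injective on columns *)

Lemma widen_ord_injective m p (le_mp : (m <= p)%N) : injective (widen_ord le_mp).
Proof. by move=> i j /(congr1 val) /= /val_inj. Qed.

(** The points carry a column index col; a filling h gives a letter to each
    point.  For the standard tableau h is the row index. *)
Section Columns.
Variables (n r : nat) (col : 'I_n -> nat).
Implicit Types (h : {ffun 'I_n -> 'I_r}).

Definition col_injective h := forall i k, col i = col k -> h i = h k -> i = k.

Definition below h i : {set 'I_n} := [set k | (col k == col i) && (h k < h i)%N].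

Lemma card_below h i : col_injective h -> (#|below h i| <= h i)%N.
Proof.
move=> hI; rewrite -(card_in_imset (f := h)) => [|k l]; last first.
  rewrite !inE => /andP[/eqP ck _] /andP [/eqP cl _]; apply: hI; congruence.
have hir : (h i <= r)%N by rewrite ltnW.
rewrite -[leqRHS]card_ord -(card_imset _ (widen_ord_injective (le_mp := hir))).
apply: subset_leq_card; apply/subsetP => v /imsetP [k]; rewrite inE => /andP [_ ki] ->.
by apply/imsetP; exists (Ordinal ki) => //; apply: val_inj.
Qed.

(** In each column the letters form an initial segment of the naturals. *)
Definition col_shape h := forall i v, (v < h i)%N -> exists2 k, col k = col i & h k = v :> nat.

Lemma card_below_shape h i : col_injective h -> col_shape h -> #|below h i| = h i.
Proof.
move=> hI hS; apply/eqP; rewrite eqn_leq card_below //=.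
rewrite -(card_in_imset (f := h)) => [|k l]; last first.
  rewrite !inE => /andP[/eqP ck _] /andP [/eqP cl _]; apply: hI; congruence.
have hir : (h i <= r)%N by rewrite ltnW.
rewrite -[leqLHS]card_ord -(card_imset _ (widen_ord_injective (le_mp := hir))).
apply: subset_leq_card; apply/subsetP => v /imsetP [k _ ->].
have [k' ck hk] := hS i _ (ltn_ord k).
by apply/imsetP; exists k'; [rewrite inE ck eqxx hk /= | apply: val_inj].
Qed.

Lemma shape_card_below h : col_injective h -> (forall i, #|below h i| = h i) -> col_shape h.
Proof.
move=> hI hB i v vi.
have hir : (h i <= r)%N by rewrite ltnW.
have /setP/(_ (widen_ord hir (Ordinal vi))) :
    h @: below h i = widen_ord hir @: [set: 'I_(h i)].
  apply/eqP; rewrite eqEcard; apply/andP; split.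
    apply/subsetP => u /imsetP [k]; rewrite inE => /andP [_ ki] ->.
    by apply/imsetP; exists (Ordinal ki) => //; apply: val_inj.
  rewrite (card_imset _ (widen_ord_injective (le_mp := hir))) cardsT card_ord -{1}hB.
  rewrite card_in_imset // => k l; rewrite !inE => /andP[/eqP ck _] /andP [/eqP cl _].
  apply: hI; congruence.
rewrite [in RHS]imset_f // => /imsetP [k]; rewrite inE => /andP [/eqP ck _] e.
by exists k; rewrite // -e.
Qed.

(** Of two distinct points in a column exactly one is below the other, so the
    sum is the same for all fillings without repetitions in the columns. *)
Lemma sum_below h : col_injective h ->
  (2 * \sum_i #|below h i| = \sum_i #|[set k | (col k == col i) && (k != i)]|)%N.
Proof.
move=> hI.
have E : (\sum_i #|below h i| = \sum_i #|[set k | (col k == col i) && (h i < h k)%N]|)%N.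
  under eq_bigr do rewrite -sum1dep_card.
  under [RHS]eq_bigr do rewrite -sum1dep_card.
  rewrite (exchange_big_dep predT) //=; apply: eq_bigr => i _; apply: eq_bigl => k.
  by rewrite eq_sym.
rewrite mul2n -addnn {2}E -big_split; apply: eq_bigr => i _ /=.
set B := [set k | _]; have I0 : below h i :&: B = set0.
  by apply/setP => k; rewrite !inE; lia.
rewrite -cardsUI I0 cards0 addn0; apply: eq_card => k; rewrite !inE -andb_orr; have [ck /=|//] := eqVneq (col k) (col i).
rewrite -neq_ltn; congr (~~ _); apply/eqP/eqP => [e|-> //].
by apply: hI => //; apply: val_inj.
Qed.

(** The letters of a column without repetitions are at least their ranks, and
    the sum of the ranks does not depend on the filling. *)
Lemma sum_shape_min h1 h2 : col_injective h1 -> col_shape h1 -> col_injective h2 ->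
  (\sum_i h1 i <= \sum_i h2 i ?= iff [forall i, #|below h2 i| == h2 i])%N.
Proof.
move=> I1 S1 I2.
have -> : (\sum_i h1 i = \sum_i #|below h2 i|)%N.
  rewrite -(eq_bigr _ (fun i _ => card_below_shape i I1 S1)).
  by have := sum_below I1; rewrite -(sum_below I2) => /eqP; rewrite eqn_pmul2l // => /eqP.
by apply: leqif_sum => i _; split; rewrite // card_below.
Qed.

(** A filling that is injective on columns and of minimal letter sum has, in each
    column, the same set of letters as the standard one, so a permutation inside
    the columns carries one into the other. *)
Lemma straighten h1 h2 : col_injective h1 -> col_shape h1 -> col_injective h2 ->
  (\sum_i h2 i <= \sum_i h1 i)%N ->
  exists q : 'S_n, (forall i, col (q i) = col i) /\ (forall i, h2 (q i) = h1 i).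
Proof.
move=> I1 S1 I2 le21.
have S2 : col_shape h2.
  apply: shape_card_below => // i; apply/eqP; move: i; apply/forallP.
  by rewrite -(sum_shape_min I1 S1 I2) eqn_leq le21 (sum_shape_min I1 S1 I2).
have ex i : exists k, (col k == col i) && (h2 k == h1 i).
  pose A h := [set h k | k in [set k | col k == col i]].
  have Adown h (u v : 'I_r) : col_shape h -> u \in A h -> (v < u)%N -> v \in A h.
    move=> hS /imsetP [k]; rewrite inE => /eqP ck -> /(hS k) [k' ck' e].
    by apply/imsetP; exists k'; [rewrite inE ck' ck | apply: val_inj].
  have cA h : col_injective h -> #|A h| = #|[set k | col k == col i]|.
    move=> hI; rewrite card_in_imset // => k l; rewrite !inE => /eqP ck /eqP cl.
    apply: hI; congruence.
  have sA h h' : col_injective h -> col_injective h' -> A h \subset A h' -> A h = A h'.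
    by move=> hI hI' sub; apply/eqP; rewrite eqEcard sub !cA ?leqnn.
  have AA : A h1 = A h2.
    have [/sA -> // | /subsetPn [u u1 u2]] := boolP (A h1 \subset A h2).
    have [/sA -> // | /subsetPn [v v2 v1]] := boolP (A h2 \subset A h1).
    have [uv|vu|/val_inj e] := ltngtP u v.
    - by case/negP: u2; apply: Adown uv.
    - by case/negP: v1; apply: Adown vu.
    - by case/negP: u2; rewrite e.
  have : h1 i \in A h2 by rewrite -AA; apply/imsetP; exists i; rewrite ?inE.
  by case/imsetP => k; rewrite inE => ck e; exists k; rewrite ck e /=.
pose q i := xchoose (ex i).
have qP i : col (q i) = col i /\ h2 (q i) = h1 i.
  by have /andP [/eqP ? /eqP ?] := xchooseP (ex i).
have qI : injective q.
  move=> i k e; apply: I1; first by rewrite -(proj1 (qP i)) -(proj1 (qP k)) e.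
  by rewrite -(proj2 (qP i)) -(proj2 (qP k)) e.
by exists (perm qI); split=> i; rewrite permE; have [] := qP i.
Qed.

End Columns.

Lemma sum_values n r (h : {ffun 'I_n -> 'I_r}) : (\sum_i h i = \sum_(v < r) v * content h v)%N.
Proof.
rewrite (partition_big h predT) //=; apply: eq_bigr => v _.
rewrite (eq_bigr (fun=> v : nat)) => [|i /eqP -> //].
by rewrite sum_nat_const mulnC; congr (_ * _)%N; apply: eq_card.
Qed.

(** The contents lam + delta - w delta that occur in the determinant have smaller
    letter sum than lam, unless w = 1.  Against [sum_shape_min] this shows that
    none of them, except lam, is the content of a filling of lam that is
    injective on columns. *)
Lemma jt_coef_weight r (lam a : 'I_r -> nat) (w : 'S_r) :
  (forall i, a i + rev_ord (w i) = beta lam i)%N ->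
  (\sum_(v < r) v * a v <= \sum_(v < r) v * lam v ?= iff (w == 1%g))%N.
Proof.
move=> aE; have [le eqE] := @sum_mul_perm r (fun i => i) w val_inj.
have E : (\sum_(v < r) v * a v + \sum_(i < r) i * i = \sum_(v < r) v * lam v + \sum_(i < r) i * w i)%N.
  rewrite -!big_split; apply: eq_bigr => i _ /=; rewrite -!mulnDr.
  have := aE i; rewrite /beta /= => e; congr (_ * _)%N.
  have := ltn_ord i; have := ltn_ord (w i); lia.
rewrite -eqE; split; first by rewrite -(leq_add2r (\sum_(i < r) i * i)) E leq_add2l.
by rewrite -(eqn_add2r (\sum_(i < r) i * i)) E eqn_add2l.
Qed.

(** * The Specht module is simple *)

Section Specht.
Variables (n r : nat) (col : 'I_n -> nat) (row : {ffun 'I_n -> 'I_r}).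
Hypothesis row_inj : col_injective col row.
Hypothesis row_shape : col_shape col row.

Local Notation G := [set: 'S_n]%G.
Local Notation aG := (regular_repr algC G).
Local Notation v1 := (delta_mx 0 (gring_index G 1%g) : 'rV[algC]_(gcard G)).

Definition adjmx m p (A : 'M[algC]_(m, p)) := map_mx Num.conj A^T.

Lemma adjmxM m p q (A : 'M_(m, p)) (B : 'M_(p, q)) :
  adjmx (A *m B) = adjmx B *m adjmx A.
Proof. by rewrite /adjmx trmx_mul map_mxM. Qed.

(** The standard Hermitian form of the group algebra is positive definite, and by
    [adj_regular] the adjoint of right multiplication by x is that by x^-1. *)
Lemma adjmx_norm_eq0 p (v : 'rV_p) : v *m adjmx v = 0 -> v = 0.
Proof.
move/matrixP/(_ 0 0); rewrite !mxE => v0; apply/matrixP => i j; rewrite ord1 mxE.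
have s0 : \sum_k `|v 0 k| ^+ 2 = 0.
  by rewrite -[RHS]v0; apply: eq_bigr => k _; rewrite normCK !mxE.
have /psumr_eq0P/(_ s0 j isT)/eqP : forall k, true -> 0 <= `|v 0 k| ^+ 2.
  by move=> k _; rewrite exprn_ge0.
by rewrite sqrf_eq0 normr_eq0 => /eqP.
Qed.

Lemma regularM x y : aG x *m aG y = aG (x * y)%g.
Proof. by rewrite repr_mxM ?inE. Qed.

Lemma v1_regular x : v1 *m aG x = delta_mx 0 (gring_index G x).
Proof. by rewrite -rowE rowK gring_indexK ?inE // mul1g. Qed.

Lemma adj_regular x : adjmx (aG x) = aG (x^-1)%g.
Proof.
apply/matrixP => i j; rewrite !mxE eqxx /= rmorph_nat; congr (nat_of_bool _)%:R.
by apply/eqP/eqP => ->; rewrite gring_indexK ?inE // (mulgK, mulgKV) gring_valK.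
Qed.

Lemma adj_sum (I : Type) (s : seq I) (P : pred I) m p (F : I -> 'M_(m, p)) :
  adjmx (\sum_(i <- s | P i) F i) = \sum_(i <- s | P i) adjmx (F i).
Proof. by rewrite /adjmx !raddf_sum. Qed.

Lemma adjZ a m p (A : 'M_(m, p)) : adjmx (a *: A) = a^* *: adjmx A.
Proof. by rewrite /adjmx linearZ /= map_mxZ. Qed.

Definition stab_sum (f : {ffun 'I_n -> 'I_r}) := \sum_(g | fixes g f) aG g.
Definition col_perm (q : 'S_n) := [forall i, col (q i) == col i].

Definition col_antisym :=
  \sum_(q : 'S_n | col_perm q) (-1) ^+ odd_perm q *: aG q.

Lemma fixesM (f : {ffun 'I_n -> 'I_r}) x g : fixes x f -> fixes (x * g)%g f = fixes g f.
Proof.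
move=> /fixesP xf; apply/fixesP/fixesP => gf i; last by rewrite permM gf.
have := gf ((x^-1)%g i); rewrite permM permKV => ->.
by rewrite -[in RHS](permKV x i) xf.
Qed.

Lemma fixesV (f : {ffun 'I_n -> 'I_r}) x : fixes (x^-1)%g f = fixes x f.
Proof.
by apply/fixesP/fixesP => xf i; [rewrite -[in RHS](permK x i) xf | rewrite -[in RHS](permKV x i) xf].
Qed.

Lemma stab_sumMl f x : fixes x f -> aG x *m stab_sum f = stab_sum f.
Proof.
move=> xf; rewrite /stab_sum mulmx_sumr [RHS](reindex_inj (mulgI x)).
by apply: eq_big => [g|g _]; rewrite ?fixesM ?regularM.
Qed.

Lemma stab_sum_sqr f : stab_sum f *m stab_sum f = #|[pred g | fixes g f]|%:R *: stab_sum f.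
Proof.
rewrite {1}/stab_sum mulmx_suml (eq_bigr (fun=> stab_sum f)) => [|x xf]; last exact: stab_sumMl.
by rewrite sumr_const scaler_nat.
Qed.

Lemma adj_stab_sum f : adjmx (stab_sum f) = stab_sum f.
Proof.
rewrite /stab_sum adj_sum [RHS](reindex_inj invg_inj).
by apply: eq_big => [g|g _]; rewrite ?fixesV ?adj_regular.
Qed.

Lemma stab_sumJ f x : aG x *m stab_sum f = stab_sum [ffun i => f (x i)] *m aG x.
Proof.
rewrite /stab_sum mulmx_suml mulmx_sumr.
rewrite [LHS](reindex_inj (conjg_inj x)); apply: eq_big => [g|g _]; last first.
  by rewrite !regularM -conjgC.
apply/fixesP/fixesP => H i.
  by have := H (x i); rewrite !ffunE conjgE !permM permK.
by have := H ((x^-1)%g i); rewrite !ffunE conjgE !permM permKV.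
Qed.

Lemma col_permM x g : col_perm x -> col_perm (g * x)%g = col_perm g.
Proof.
by move=> /'forall_eqP xc; apply/'forall_eqP/'forall_eqP => gc i; have := gc i; rewrite permM xc.
Qed.

Lemma col_permV x : col_perm (x^-1)%g = col_perm x.
Proof.
by apply/'forall_eqP/'forall_eqP => xc i; [rewrite -[in RHS](permK x i) xc | rewrite -[in RHS](permKV x i) xc].
Qed.

Lemma col_antisymMr x : col_perm x -> col_antisym *m aG x = (-1) ^+ odd_perm x *: col_antisym.
Proof.
move=> xc; rewrite /col_antisym mulmx_suml scaler_sumr [RHS](reindex_inj (mulIg x)).
apply: eq_big => [g|g _]; first by rewrite col_permM.
by rewrite -scalemxAl regularM scalerA odd_permM addbC signr_addb mulrA -signr_addb addbb mul1r.
Qed.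

Lemma adj_col_antisym : adjmx col_antisym = col_antisym.
Proof.
rewrite /col_antisym adj_sum [RHS](reindex_inj invg_inj).
apply: eq_big => [g|g _]; first by rewrite col_permV.
by rewrite adjZ adj_regular odd_permV rmorph_sign.
Qed.

(** A transposition of two points in one column with the same letter is absorbed
    by both factors, with opposite signs. *)
Lemma col_antisym_stab_sum f : ~ col_injective col f -> col_antisym *m stab_sum f = 0.
Proof.
move=> nI.
have /existsP [[i k] /= /and3P [/eqP cik /eqP fik nik]] :
    [exists p : 'I_n * 'I_n, [&& col p.1 == col p.2, f p.1 == f p.2 & p.1 != p.2]].
  apply: contraT => /existsPn no; case: nI => i k cik fik.
  by have := no (i, k); rewrite /= cik fik !eqxx /= negbK => /eqP.
have tc : col_perm (tperm i k) by apply/'forall_eqP => j; case: tpermP => // ->.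
have tf : fixes (tperm i k) f by apply/fixesP => j; case: tpermP => // ->.
have : col_antisym *m stab_sum f = - (col_antisym *m stab_sum f).
  by rewrite -{1}(stab_sumMl tf) mulmxA col_antisymMr // odd_tperm nik expr1 scaleN1r mulNmx.
by move/eqP; rewrite -addr_eq0 -mulr2n -scaler_nat scaler_eq0 pnatr_eq0 => /eqP.
Qed.
Definition col_injb (f : {ffun 'I_n -> 'I_r}) :=
  [forall i, forall k, (col i == col k) && (f i == f k) ==> (i == k)].

Lemma col_injP f : reflect (col_injective col f) (col_injb f).
Proof.
apply: (iffP forallP) => [H i k cik fik|H i].
  by apply/eqP; have /forallP/(_ k) := H i; rewrite cik fik !eqxx.
by apply/forallP => k; apply/implyP => /andP [/eqP cik /eqP /(H _ _ cik) ->].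
Qed.

(** With a = stab_sum row and b = col_antisym, either b kills x a, or x is the
    product of a column permutation and a row permutation. *)
Lemma col_row_sandwich x : exists c,
  col_antisym *m aG x *m stab_sum row = c *: (col_antisym *m stab_sum row).
Proof.
have [/col_injP fI|/col_injP fI] := boolP (col_injb [ffun i => row (x i)]); last first.
  by exists 0; rewrite scale0r -mulmxA stab_sumJ mulmxA col_antisym_stab_sum ?mul0mx.
have [|q [qc qf]] := straighten row_inj row_shape fI.
  rewrite [leqRHS](reindex_inj (@perm_inj _ x)) /=.
  by apply: eq_leq; apply: eq_bigr => i _; rewrite ffunE.
have qC : col_perm q by apply/'forall_eqP.
have qR : fixes (q * x)%g row.
  by apply/fixesP => i; have := qf i; rewrite ffunE permM.
exists ((-1) ^+ odd_perm q); rewrite scalemxAl -[in LHS](mulKg q x) -regularM.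
rewrite mulmxA -[LHS]mulmxA stab_sumMl // col_antisymMr ?col_permV //.
by rewrite odd_permV.
Qed.

Definition specht_gen := v1 *m (stab_sum row *m col_antisym).
Local Notation v0 := specht_gen.
Local Notation S := (cyclic_mx aG v0).

Lemma specht_genE : v0 = \sum_(p | fixes p row) \sum_(q | col_perm q)
  (-1) ^+ odd_perm q *: delta_mx 0 (gring_index G (p * q)%g).
Proof.
rewrite /specht_gen /stab_sum /col_antisym mulmx_suml mulmx_sumr; apply: eq_bigr => p _.
rewrite !mulmx_sumr; apply: eq_bigr => q _.
by rewrite -!scalemxAr regularM v1_regular.
Qed.

Lemma fixes1 (f : {ffun 'I_n -> 'I_r}) : fixes 1%g f.
Proof. by apply/fixesP => i; rewrite perm1. Qed.

(** The coefficient of the identity in the Young symmetrizer is 1, as the row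
    group and the column group meet trivially. *)
Lemma specht_gen_neq0 : v0 != 0.
Proof.
apply/eqP => /matrixP/(_ 0 (gring_index G 1%g)).
have E (p q : 'S_n) : ((-1) ^+ odd_perm q *: (delta_mx 0 (gring_index G (p * q)%g) : 'rV_(gcard G)))
     0 (gring_index G 1%g) = ((-1) ^+ odd_perm q *+ (q == p^-1)%g : algC).
  rewrite !mxE eqxx /= -(inj_eq (can_inj gring_valK)) !gring_indexK ?inE //.
  by rewrite eq_sym -eq_invg_mul eq_sym mulr_natr.
rewrite [RHS]mxE specht_genE summxE (bigD1 1%g) ?fixes1 //= [X in _ + X]big1 => [|p /andP [pr p1]]; last first.
  rewrite summxE big1 // => q qc; rewrite E.
  case: eqP => // qp; case/eqP: p1; apply/permP => i; rewrite perm1; apply: row_inj.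
    by move: qc; rewrite qp col_permV => /'forall_eqP ->.
  by rewrite (fixesP _ _ pr).
have c1 : col_perm 1%g by apply/'forall_eqP => i; rewrite perm1.
rewrite addr0 summxE (bigD1 1%g) //= E invg1 eqxx odd_perm1 big1 ?addr0 => [|q /andP [_ q1]].
  by move/eqP; rewrite oner_eq0.
by rewrite E invg1 (negbTE q1).
Qed.

(** With a = stab_sum row and b = col_antisym, the squared norm of a b is the
    coefficient of the identity in a b b a, which is the order of the column
    group times a b a. *)
Lemma specht_gen_stab_neq0 : v0 *m stab_sum row != 0.
Proof.
apply: contraNneq specht_gen_neq0 => v0R.
apply/eqP/adjmx_norm_eq0; rewrite {2}/specht_gen !adjmxM adj_stab_sum adj_col_antisym.
have colsqr : col_antisym *m col_antisym = #|[pred q | col_perm q]|%:R *: col_antisym.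
  rewrite {2}/col_antisym mulmx_sumr (eq_bigr (fun=> col_antisym)) => [|q qc].
    by rewrite sumr_const scaler_nat.
  by rewrite -scalemxAr col_antisymMr // scalerA -signr_addb addbb scale1r.
rewrite 2!mulmxA {1}/specht_gen -!mulmxA (mulmxA col_antisym) colsqr.
rewrite -!scalemxAl -!scalemxAr !mulmxA -(mulmxA v1) -/specht_gen v0R mul0mx scaler0 //.
Qed.

Lemma stab_sum_envelop f : (stab_sum f \in enveloping_algebra_mx aG)%MS.
Proof.
by rewrite linear_sum summx_sub // => g _; rewrite envelop_mx_id ?inE.
Qed.

Lemma col_antisym_envelop : (col_antisym \in enveloping_algebra_mx aG)%MS.
Proof.
by rewrite linear_sum summx_sub // => g _; rewrite linearZ scalemx_sub ?envelop_mx_id ?inE.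
Qed.

Lemma adj_envelop A : (A \in enveloping_algebra_mx aG)%MS ->
  (adjmx A \in enveloping_algebra_mx aG)%MS.
Proof.
case/envelop_mxP => a ->; rewrite adj_sum linear_sum summx_sub // => g _.
by rewrite adjZ adj_regular linearZ scalemx_sub ?envelop_mx_id ?inE.
Qed.

Lemma specht_stab A : (A \in enveloping_algebra_mx aG)%MS ->
  exists c, v0 *m A *m stab_sum row = c *: (v0 *m stab_sum row).
Proof.
case/envelop_mxP => a ->.
have [c cE] := fin_all_exists col_row_sandwich; exists (\sum_x a x * c x).
rewrite [v0 *m _]mulmx_sumr mulmx_suml scaler_suml.
rewrite big_mkcond /=; apply: eq_bigr => x _; rewrite inE.
rewrite -scalemxAr -scalemxAl -scalerA; congr (_ *: _).
rewrite /specht_gen -!mulmxA (mulmxA col_antisym) cE.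
by rewrite -!scalemxAr.
Qed.

(** If v = v0 A is a nonzero vector of V, then v times the adjoint of (a b A) has
    the squared norm of v as its coefficient at the identity; so V contains a
    vector w with w a nonzero, and V a is inside the line spanned by v0 a. *)
Lemma stab_line_sub m (V : 'M_(m, _)) :
  mxmodule aG V -> (V <= S)%MS -> V != 0 -> (v0 *m stab_sum row <= V)%MS.
Proof.
move=> modV VS /rowV0Pn [v vV v_neq0].
have /cyclic_mxP [A EA vE] := submx_trans vV VS.
pose w := v *m (adjmx A *m col_antisym).
have wV : (w <= V)%MS.
  by apply: mxmodule_envelop modV _ vV; rewrite envelop_mxM ?adj_envelop ?col_antisym_envelop.
have /cyclic_mxP [A' EA' wE] := submx_trans wV VS.
have [c cE] := specht_stab EA'.
have wR_neq0 : w *m stab_sum row != 0.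
  apply: contraNneq v_neq0 => wR0; apply/eqP/adjmx_norm_eq0.
  rewrite {2}vE /specht_gen !adjmxM adj_stab_sum adj_col_antisym !mulmxA.
  by rewrite -(mulmxA v) -/w wR0 mul0mx.
have c_neq0 : c != 0.
  by apply: contraNneq wR_neq0 => c0; rewrite wE cE c0 scale0r.
rewrite -[v0 *m _](scalerK c_neq0) -cE -wE scalemx_sub //.
by apply: mxmodule_envelop modV _ wV; apply: stab_sum_envelop.
Qed.

(** A proper submodule and a complement would both contain the vector v0 a. *)
Lemma specht_simple : mxsimple aG S.
Proof.
have modS := cyclic_mx_module aG v0.
split=> //; first by rewrite cyclic_mx_eq0 specht_gen_neq0.
move=> V modV VS V_neq0.
have redS : mx_completely_reducible aG S.
  apply: mx_reducibleS (submx1 _) _ => //.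
  by apply: mx_Maschke_pchar; apply: algC'G_pchar.
have [W modW defS /mxdirect_addsP VW0] := redS V modV VS.
have [W0|W_neq0] := eqVneq W 0; first by rewrite -defS W0 addsmx0.
have WS : (W <= S)%MS by rewrite -defS addsmxSr.
case/negP: specht_gen_stab_neq0; rewrite -submx0 -VW0 sub_capmx.
by rewrite !stab_line_sub.
Qed.
End Specht.

(** * The character of the Specht module *)

(** T is s times a projection; s = 0 is covered, as T then has trace 0. *)
Lemma mxtrace_quasi_idem (F : fieldType) m (T : 'M[F]_m) s :
  T *m T = s *: T -> \tr T = s * (\rank T)%:R.
Proof.
have cancel k (C : 'M[F]_(m, k)) (B : 'M_(k, m)) B' C' : B' *m C = 1%:M -> B *m C' = 1%:M ->
    C *m B *m (C *m B) = s *: (C *m B) -> B *m C = s%:M.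
  move=> BK CK; move/(congr1 (fun X => B' *m X *m C')).
  rewrite -scalemxAr -scalemxAl -!mulmxA CK !mulmx1 BK (mulmxA B') BK mul1mx.
  by rewrite scalemx1.
have [C' CK] := row_freeP (row_base_free T); have [B' BK] := row_fullP (col_base_full T).
move=> TT; have E : row_base T *m col_base T = s%:M.
  by apply: cancel BK CK _; rewrite mulmx_base.
transitivity (\tr (col_base T *m row_base T)); first by rewrite mulmx_base.
by rewrite mxtrace_mulC E mxtrace_scalar mulr_natr.
Qed.

Lemma intr_sum (R : pzRingType) (I : Type) (s : seq I) (P : pred I) (F : I -> int) :
  (\sum_(i <- s | P i) F i)%:~R = \sum_(i <- s | P i) (F i)%:~R :> R.
Proof. exact: (big_morph _ (fun a b => mulrzDr 1 a b) (mulr0z 1)). Qed.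

Section SpechtCharacter.
Variables (n r : nat) (col : 'I_n -> nat) (row : {ffun 'I_n -> 'I_r}).
Hypothesis row_inj : col_injective col row.
Hypothesis row_shape : col_shape col row.

Local Notation G := [set: 'S_n]%G.
Local Notation aG := (regular_repr algC G).
Local Notation S := (cyclic_mx aG (specht_gen col row)).
Local Notation chi := (cfRepr (submod_repr (cyclic_mx_module aG (specht_gen col row)))).

(** The sum of the stabilizer of f acts on the Specht module as the order of the
    stabilizer times the projection onto its fixed vectors, and the trace of a
    projection is its rank. *)
Lemma sum_specht_stab (f : {ffun 'I_n -> 'I_r}) :
  \sum_(g | fixes g f) chi g = #|[pred g | fixes g f]|%:R * (\rank (S *m stab_sum f))%:R.
Proof.
set modS := cyclic_mx_module _ _; pose T := \sum_(g | fixes g f) submod_mx modS g.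
have valT m (W : 'M_(m, _)) : val_submod (W *m T) = val_submod W *m stab_sum f.
  rewrite /T /stab_sum !mulmx_sumr linear_sum; apply: eq_bigr => g _.
  by rewrite /= val_submodJ ?inE.
have vT : val_submod T = val_submod (1%:M : 'M_(\rank S)) *m stab_sum f.
  by rewrite -valT mul1mx.
transitivity (\tr T).
  by rewrite /T linear_sum; apply: eq_bigr => g _; rewrite cfunE inE mulr1n.
rewrite (@mxtrace_quasi_idem _ _ T #|[pred g | fixes g f]|%:R); last first.
  apply: val_submod_inj; rewrite valT linearZ /= vT -mulmxA stab_sum_sqr.
  by rewrite -scalemxAr.
congr (_ * _%:R); rewrite -(eqmxMr _ (val_submod1 S)) -valT mul1mx.
by rewrite mxrankMfree ?row_base_free.
Qed.

Lemma rank_specht_stab0 (f : {ffun 'I_n -> 'I_r}) :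
  (forall x : 'S_n, ~ col_injective col [ffun i => f (x i)]) ->
  \rank (S *m stab_sum f) = 0%N.
Proof.
move=> nI; apply/eqP; rewrite mxrank_eq0 -submx0; apply/row_subP => i.
rewrite row_mul; have /cyclic_mxP [_ /envelop_mxP [a ->] ->] := row_sub i S.
rewrite [specht_gen _ _ *m _]mulmx_sumr mulmx_suml summx_sub // => x _.
rewrite -scalemxAr -scalemxAl /specht_gen -!mulmxA stab_sumJ (mulmxA (col_antisym col)).
by rewrite col_antisym_stab_sum // !(mul0mx, mulmx0) scaler0 sub0mx.
Qed.

Lemma rank_specht_stab1 (f : {ffun 'I_n -> 'I_r}) :
  content f =1 content row -> \rank (S *m stab_sum f) = 1%N.
Proof.
move=> fr; have [|y fE] := @eq_content_perm _ _ row f; first by move=> v; rewrite fr.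
have PfE : stab_sum f = aG y *m stab_sum row *m aG (y^-1)%g.
  rewrite stab_sumJ -mulmxA regularM mulgV repr_mx1 mulmx1; congr stab_sum.
  by apply/ffunP => i; rewrite ffunE.
have unity : aG (y^-1)%g \in unitmx by rewrite repr_mx_unit ?inE.
rewrite PfE !mulmxA mxrankMfree ?row_free_unit //.
have Sy : (S *m aG y :=: S)%MS.
  have modS := cyclic_mx_module aG (specht_gen col row).
  apply/eqmxP; rewrite mxmodule_trans ?inE //=.
  rewrite -[X in (X <= _)%MS](repr_mxKV aG (in_setT y)) submxMr //.
  by apply: mxmodule_trans; rewrite ?groupV ?inE.
rewrite (eqmxMr _ Sy).
have -> : 1%N = \rank (specht_gen col row *m stab_sum row).
  apply/esym/eqP; rewrite eqn_leq rank_leq_row lt0n mxrank_eq0.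
  exact: specht_gen_stab_neq0.
apply/eqmx_rank/andP; split; last by rewrite submxMr ?cyclic_mx_id.
apply/row_subP => i; rewrite row_mul.
have /cyclic_mxP [A EA ->] := row_sub i S.
by have [c ->] := specht_stab row_inj row_shape EA; rewrite scalemx_sub.
Qed.

(** A nonzero rank forces f, up to the action of S_n, to be injective on columns,
    and this excludes all contents of the determinant except lam. *)
Lemma jt_coef_rank (lam : 'I_r -> nat) (f : {ffun 'I_n -> 'I_r}) :
  content row =1 lam ->
  (jt_coef lam (content f))%:~R * (\rank (S *m stab_sum f))%:R =
    [forall v, content f v == lam v]%:R :> algC.
Proof.
move=> rl; have [eq_f|neq_f] := boolP [forall v, content f v == lam v].
  have eqf v : content f v = lam v by apply/eqP/(forallP eq_f).
  rewrite rank_specht_stab1 => [|v]; last by rewrite eqf rl.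
  rewrite mulr1 /jt_coef (bigD1 1%g) //= odd_perm1 mul1r big1 ?addr0 => [|w w1].
    by case: forallP => // -[] i; rewrite perm1 eqf.
  case: forallP => [aE|_]; last by rewrite mulr0.
  have := jt_coef_weight (fun i => eqP (aE i)); case: (w =P 1%g) w1 => // _ _.
  rewrite (eq_bigr (fun v : 'I_r => v * lam v)%N) => [[_]|v _]; last by rewrite eqf.
  by rewrite eqxx.
have [fI|nI] := boolP [exists x : 'S_n, col_injb col [ffun i => f (x i)]]; last first.
  rewrite rank_specht_stab0 ?mulr0 // => x /col_injP fx.
  by case/existsP: nI; exists x.
have [x /col_injP fx] := existsP fI.
rewrite /jt_coef big1 ?mul0r // => w _; case: forallP => [aE|_]; last by rewrite mulr0.
have [le_w] := jt_coef_weight (fun i => eqP (aE i)).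
have : (\sum_(v < r) v * lam v <= \sum_(v < r) v * content f v)%N.
  rewrite -(eq_bigr _ (fun v _ => congr1 (muln (nat_of_ord v)) (rl v))) -!sum_values.
  rewrite [leqRHS](reindex_inj (@perm_inj _ x)) /=.
  rewrite [leqRHS](eq_bigr (fun i => nat_of_ord ([ffun i => f (x i)] i))) => [|i _]; last by rewrite ffunE.
  exact: (sum_shape_min row_inj row_shape fx).
move=> ge_w; rewrite eqn_leq le_w ge_w /= => /esym/eqP w1.
case/forallPn: neq_f => v; case/eqP; have /eqP := aE v.
by rewrite w1 perm1 /beta => /addIn.
Qed.

(** Two functions of norm 1 with inner product 1 coincide. *)
Lemma specht_jt_char (lam : 'I_r -> nat) g :
  (forall i k : 'I_r, (i <= k)%N -> (lam k <= lam i)%N) ->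
  content row =1 lam -> chi g = (jt_char lam g)%:~R.
Proof.
move=> lam_dec rl.
have sum_lam : (\sum_i lam i = n)%N.
  by rewrite -(eq_bigr _ (fun v _ => rl v)) sum_content.
have nf : (n`!%:R : algC) = #|G|%:R by rewrite cardsT card_Sn.
have S1 : \sum_(g : 'S_n) chi g * (jt_char lam g)%:~R = n`!%:R.
  pose phi (c : {ffun 'I_r -> nat}) : algC := [forall v, c v == lam v]%:R.
  transitivity (\sum_(g : 'S_n) \sum_(f : {ffun 'I_n -> 'I_r} | fixes g f)
     phi (finfun (content f))); last first.
    rewrite sum_fixes_content.
    pose D : {ffun 'I_r -> 'I_n.+1} := [ffun v => inord (lam v)].
    have DE v : D v = lam v :> nat.
      by rewrite ffunE inordK // ltnS -sum_lam (bigD1 v) //= leq_addr.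
    rewrite (bigD1 D) /=; last by rewrite (eq_bigr _ (fun v _ => DE v)) sum_lam.
    rewrite big1 => [|N /andP [_ ND]].
      rewrite addr0 /phi; case: forallP => // -[] v; by rewrite ffunE DE.
    rewrite /phi; case: forallP => // NE; case/eqP: ND; apply/ffunP => v.
    by apply: val_inj; have := NE v; rewrite ffunE /= DE => /eqP.
  rewrite [RHS](exchange_big_dep predT) //=.
  transitivity (\sum_(h : 'S_n) \sum_(f : {ffun 'I_n -> 'I_r} | fixes h f)
      chi h * (jt_coef lam (content f))%:~R).
    by apply: eq_bigr => h _; rewrite /jt_char intr_sum mulr_sumr.
  rewrite (exchange_big_dep predT) //=; apply: eq_bigr => f _.
  rewrite -mulr_suml sum_specht_stab -mulrA [X in _ * X]mulrC jt_coef_rank //.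
  rewrite sumr_const mulr_natl; congr ((nat_of_bool _)%:R *+ _).
  by apply: eq_forallb => v; rewrite ffunE.
have S2 : \sum_(g : 'S_n) (jt_char lam g)%:~R ^+ 2 = n`!%:R :> algC.
  transitivity ((\sum_(g : 'S_n) jt_char lam g ^+ 2)%:~R : algC).
    by rewrite intr_sum; apply: eq_bigr => h _; rewrite rmorphXn.
  by rewrite (norm_jt_char lam_dec sum_lam) rmorph_nat.
have S3 : \sum_(g : 'S_n) `|chi g| ^+ 2 = n`!%:R :> algC.
  have /irr_reprP : exists2 rG : representation algC G, mx_irreducible rG & chi = cfRepr rG.
    exists (Representation (submod_repr (cyclic_mx_module aG (specht_gen col row)))) => //=.
    by apply/submod_mx_irr; apply: specht_simple.
  move=> /irrP [i chiE]; have := cfnorm_irr i; rewrite -chiE.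
  rewrite (cfnormE (cfun_onG _)) => /(canRL (mulVKf _)).
  rewrite mulr1 -nf => <-; first by apply: eq_bigl => h; rewrite inE.
  by rewrite nf pnatr_eq0 -lt0n cardG_gt0.
have /psumr_eq0P : \sum_(g : 'S_n) `|chi g - (jt_char lam g)%:~R| ^+ 2 = 0.
  transitivity (\sum_(g : 'S_n) (`|chi g| ^+ 2 - chi g * (jt_char lam g)%:~R
        - (chi g * (jt_char lam g)%:~R)^* + (jt_char lam g)%:~R ^+ 2)).
    apply: eq_bigr => h _; rewrite !normCK rmorphB rmorphM /= rmorph_int.
    by rewrite mulrBl !mulrBr expr2 opprB addrA; ring.
  by rewrite !big_split !sumrN -rmorph_sum /= S1 S2 S3 rmorph_nat; ring.
move=> /(_ (fun h _ => exprn_ge0 2 (normr_ge0 _)))/(_ g isT)/eqP.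
by rewrite sqrf_eq0 normr_eq0 subr_eq0 => /eqP.
Qed.
End SpechtCharacter.

(** * The standard tableau *)

Section Tableau.
Variables (n r : nat) (sh : seq nat).
Hypotheses (size_sh : size sh = r) (sum_sh : sumn sh = n) (dec_sh : sorted geq sh).

Lemma row_of_subproof (i : 'I_n) : (reshape_index sh i < r)%N.
Proof. by rewrite -size_sh reshape_indexP // sum_sh. Qed.

Definition row_of : {ffun 'I_n -> 'I_r} := [ffun i => Ordinal (row_of_subproof i)].

Local Notation col_of := (fun i : 'I_n => reshape_offset sh i).

Lemma row_ofE i : row_of i = reshape_index sh i :> nat.
Proof. by rewrite ffunE. Qed.

Lemma nth_dec i k : (i <= k)%N -> (nth 0 sh k <= nth 0 sh i)%N.
Proof.
move=> ik; have [kn|kn] := ltnP k (size sh); last by rewrite (nth_default _ kn).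
by apply: (sorted_leq_nth (leT := geq)) => //; first [exact: rev_trans leq_trans | exact: leqnn | rewrite inE; apply: leq_ltn_trans kn].
Qed.

Lemma row_of_inj : col_injective col_of row_of.
Proof.
move=> i k ck /(congr1 val); rewrite /= !row_ofE => rk; apply: val_inj.
by rewrite /= -(reshape_indexK sh i) -(reshape_indexK sh k) ck rk.
Qed.

Lemma cell_subproof v c : (c < nth 0 sh v)%N -> (flatten_index sh v c < n)%N.
Proof. by rewrite -sum_sh; apply: flatten_indexP. Qed.

Lemma row_of_shape : col_shape col_of row_of.
Proof.
move=> i v; rewrite row_ofE => vi.
have lt_c : (col_of i < nth 0 sh v)%N.
  by apply: leq_trans (nth_dec (ltnW vi)); apply: reshape_offsetP; rewrite sum_sh.
exists (Ordinal (cell_subproof lt_c)); rewrite ?row_ofE /=.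
  by rewrite flatten_indexKr.
by rewrite flatten_indexKl.
Qed.

Lemma content_row_of (v : 'I_r) : content row_of v = nth 0%N sh v.
Proof.
pose cell (c : 'I_(nth 0%N sh v)) := Ordinal (cell_subproof (ltn_ord c)).
have cell_inj : injective cell.
  move=> c c' /(congr1 val) /= e; apply: val_inj => /=.
  by rewrite -(flatten_indexKr (ltn_ord c)) e flatten_indexKr.
rewrite -[RHS]card_ord -(card_imset _ cell_inj); apply: eq_card => i; rewrite inE.
apply/eqP/imsetP => [iv|[c _ ->]]; last first.
  by apply: val_inj; rewrite /= row_ofE /= flatten_indexKl.
have iv' : reshape_index sh i = v by rewrite -row_ofE iv.
have lt_c : (reshape_offset sh i < nth 0 sh v)%N.
  by rewrite -iv'; apply: reshape_offsetP; rewrite sum_sh.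
exists (Ordinal lt_c) => //; apply: val_inj => /=.
by rewrite -iv' reshape_indexK.
Qed.

Lemma young_symmE : young_symm n sh = specht_gen col_of row_of.
Proof.
rewrite specht_genE; apply: eq_big => [p|p _]; last first.
  by apply: eq_bigl => q; rewrite inE.
rewrite inE; apply: eq_forallb => i.
by rewrite -(inj_eq val_inj) /= !row_ofE.
Qed.

Lemma symm_charE g : symm_char n sh g = (jt_char (fun v : 'I_r => nth 0%N sh v) g)%:~R.
Proof.
rewrite /symm_char young_symmE.
rewrite (specht_jt_char row_of_inj row_of_shape _ (lam := fun v : 'I_r => nth 0%N sh v)) //.
  by move=> i k; apply: nth_dec.
exact: content_row_of.
Qed.
End Tableau.

(** * Alternating sums over four letters *)

Lemma sum_perm_recl n (V : nmodType) (F : 'S_n.+1 -> V) :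
  \sum_w F w = \sum_(j < n.+1) \sum_(s : 'S_n) F (lift_perm ord0 j s).
Proof.
rewrite pair_big /=; pose h (p : 'I_n.+1 * 'S_n) := lift_perm ord0 p.1 p.2.
rewrite (reindex h) //=; apply: onW_bij; apply: inj_card_bij.
  move=> [j s] [j' s']; rewrite /h /= => e.
  have ej : j = j' by rewrite -(lift_perm_id ord0 j s) e lift_perm_id.
  rewrite ej in e *; congr (_, _); apply/permP => i; apply: (@lift_inj _ j').
  by rewrite -!(lift_perm_lift ord0) e.
have cS m : #|{: 'S_m}| = m`! by rewrite -card_Sn; apply: eq_card => s; rewrite inE.
  by rewrite card_prod card_ord !cS factS.
Qed.

Lemma sum_perm0 (V : nmodType) (F : 'S_0 -> V) : \sum_s F s = F 1%g.
Proof.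
by rewrite (bigD1 1%g) //= big1 ?addr0 // => s /eqP []; apply/permP => -[].
Qed.

Definition o0 : 'I_4 := ord0.
Definition o1 : 'I_4 := lift ord0 ord0.
Definition o2 : 'I_4 := lift ord0 (lift ord0 ord0).
Definition o3 : 'I_4 := lift ord0 (lift ord0 (lift ord0 ord0)).

(** The summand is taken as a function on naturals, so that the images of w turn
    into numerals. *)
Lemma sum_S4 (F : nat -> nat -> nat -> nat -> int) :
  \sum_(w : 'S_4) (-1) ^+ odd_perm w * F (w o0) (w o1) (w o2) (w o3) =
    (F 0%N 1%N 2%N 3%N - F 0%N 1%N 3%N 2%N - F 0%N 2%N 1%N 3%N + F 0%N 2%N 3%N 1%N + F 0%N 3%N 1%N 2%N - F 0%N 3%N 2%N 1%N)
  - (F 1%N 0%N 2%N 3%N - F 1%N 0%N 3%N 2%N - F 1%N 2%N 0%N 3%N + F 1%N 2%N 3%N 0%N + F 1%N 3%N 0%N 2%N - F 1%N 3%N 2%N 0%N)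
  + (F 2%N 0%N 1%N 3%N - F 2%N 0%N 3%N 1%N - F 2%N 1%N 0%N 3%N + F 2%N 1%N 3%N 0%N + F 2%N 3%N 0%N 1%N - F 2%N 3%N 1%N 0%N)
  - (F 3%N 0%N 1%N 2%N - F 3%N 0%N 2%N 1%N - F 3%N 1%N 0%N 2%N + F 3%N 1%N 2%N 0%N + F 3%N 2%N 0%N 1%N - F 3%N 2%N 1%N 0%N) :> int.
Proof.
rewrite sum_perm_recl; under eq_bigr do rewrite sum_perm_recl.
under eq_bigr do under eq_bigr do rewrite sum_perm_recl.
under eq_bigr do under eq_bigr do under eq_bigr do rewrite sum_perm_recl.
under eq_bigr do under eq_bigr do under eq_bigr do under eq_bigr do
  rewrite sum_perm0 !odd_lift_perm odd_perm1 !(lift_perm_id, lift_perm_lift).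
rewrite !big_ord_recl !big_ord0 /=.
rewrite /bump /= ?expr0 ?expr1.
ring.
Qed.

(** The coefficient extraction y^a |-> constant term of y^a / (y - 1/y), with
    1 / (y - 1/y) expanded in powers of 1/y. *)
Definition posodd (a : int) : int := ((0 < a) && odd `|a|)%:R.

(** Multiplication by y - 1/y gives back the constant term. *)
Lemma posodd_rec a : posodd (a + 2) = posodd a + (a + 1 == 0)%:R.
Proof.
rewrite /posodd; case: (ltrgtP a (- 1)) => [a_lt|a_gt|->] //.
- have -> : (0 < a + 2) = false by lia.
  have -> : (0 < a) = false by lia.
  by have -> : (a + 1 == 0) = false by lia.
- have -> : (a + 1 == 0) = false by lia.
  have -> : (0 < a + 2) by lia.
  have -> : odd `|a + 2| = odd `|a| by lia.
  have [->|a0] := eqVneq a 0; first by rewrite ltxx absz0 addr0.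
  by have -> : 0 < a; [lia | rewrite addr0].
Qed.

(** As posodd, with y^a multiplied by y^2 + 1 + y^(-2), by y^2 + y^(-2) and by
    y + 1/y. *)
Definition wtA a := posodd (a + 2) + posodd a + posodd (a - 2).
Definition wtB a := posodd (a + 2) + posodd (a - 2).
Definition wtC a := posodd (a + 1) + posodd (a - 1).

(** The constant term of y^a z^b (h_2(y, z, 1/z, 1/y) - 1) / ((y - 1/y)(z - 1/z)),
    for which the nine terms of h_2 - 1 are grouped by their dependence on z. *)
Definition weight_sq (a b : int) := wtA a * posodd b + posodd a * wtB b + wtC a * wtC b.

(** Twice the coefficients that extract [k+1, k-1] from p_g(t, 1/t), made
    invariant under t |-> 1/t. *)
Definition kappa (e : int) : int :=
  (e == 2)%:R + (e == - 2)%:R - (e == 4)%:R - (e == - 4)%:R.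

Lemma posodd_shift (a : int) (m : nat) :
  posodd (a + m.+2%:Z - 5) = posodd (a + m%:Z - 5) + (a + m%:Z - 4 == 0)%:R.
Proof.
rewrite (_ : a + m.+2%:Z - 5 = a + m%:Z - 5 + 2); last by lia.
by rewrite posodd_rec; congr (_ + (_ == _)%:R); lia.
Qed.

(** The alternating sum multiplies the argument by a_delta(y, z, 1/z, 1/y), which
    is divisible by (y - 1/y)(z - 1/z): a product of two constant terms remains. *)
Lemma antisym_weight_sq (a b : int) :
  \sum_(w : 'S_4) (-1) ^+ odd_perm w *
     weight_sq (a + ((w o3)%:Z - (w o0)%:Z)) (b + ((w o2)%:Z - (w o1)%:Z))
  = kappa (a + b) * kappa (a - b).
Proof.
(* The shifts of a and b range over -5 .. 5; an offset of 5 makes them natural. *)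
pose U m := posodd (a + m%:Z - 5); pose V m := posodd (b + m%:Z - 5).
pose D (m : nat) : int := (a + m%:Z - 4 == 0)%:R.
pose E (m : nat) : int := (b + m%:Z - 4 == 0)%:R.
have UE m : U m.+2 = U m + D m by exact: posodd_shift.
have VE m : V m.+2 = V m + E m by exact: posodd_shift.
pose F (i j k l : nat) : int :=
  (U (l + 7 - i)%N + U (l + 5 - i)%N + U (l + 3 - i)%N) * V (k + 5 - j)%N
  + U (l + 5 - i)%N * (V (k + 7 - j)%N + V (k + 3 - j)%N)
  + (U (l + 6 - i)%N + U (l + 4 - i)%N) * (V (k + 6 - j)%N + V (k + 4 - j)%N).
transitivity (\sum_(w : 'S_4) (-1) ^+ odd_perm w * F (w o0) (w o1) (w o2) (w o3)).
  apply: eq_bigr => w _; congr (_ * _); rewrite /F /weight_sq /wtA /wtB /wtC /U /V.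
  have := ltn_ord (w o0); have := ltn_ord (w o1).
  move: (w o0 : nat) (w o1 : nat) (w o2 : nat) (w o3 : nat) => i j k l lj li.
  by congr ((posodd _ + posodd _ + posodd _) * posodd _ + posodd _ * (posodd _ + posodd _)
     + (posodd _ + posodd _) * (posodd _ + posodd _)); lia.
rewrite sum_S4 {}/F; cbv [addn subn Nat.add Nat.sub].
rewrite !UE !VE.
(* The sixteen products of kappa: a + b and a - b are +-2 or +-4. *)
transitivity (D 2%N * E 4%N + D 4%N * E 2%N - D 1%N * E 5%N - D 5%N * E 1%N + D 4%N * E 6%N + D 6%N * E 4%N
  - D 3%N * E 7%N - D 7%N * E 3%N - D 1%N * E 3%N - D 3%N * E 1%N + D 0%N * E 4%N + D 4%N * E 0%N
  - D 5%N * E 7%N - D 7%N * E 5%N + D 4%N * E 8%N + D 8%N * E 4%N).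
  ring.
have DE (m p : nat) (e e' : int) : e = 8 - m%:Z - p%:Z -> e' = p%:Z - m%:Z ->
    D m * E p = (a + b == e)%:R * (a - b == e')%:R.
  move=> -> ->; rewrite /D /E -!natrM !mulnb; congr (nat_of_bool _)%:R.
  by apply/andP/andP => -[/eqP h1 /eqP h2]; split; apply/eqP; lia.
rewrite (@DE 2 4 2 2) //.
rewrite (@DE 4 2 2 (- 2)) //.
rewrite (@DE 1 5 2 4) //.
rewrite (@DE 5 1 2 (- 4)) //.
rewrite (@DE 4 6 (- 2) 2) //.
rewrite (@DE 6 4 (- 2) (- 2)) //.
rewrite (@DE 3 7 (- 2) 4) //.
rewrite (@DE 7 3 (- 2) (- 4)) //.
rewrite (@DE 1 3 4 2) //.
rewrite (@DE 3 1 4 (- 2)) //.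
rewrite (@DE 0 4 4 4) //.
rewrite (@DE 4 0 4 (- 4)) //.
rewrite (@DE 5 7 (- 4) 2) //.
rewrite (@DE 7 5 (- 4) (- 2)) //.
rewrite (@DE 4 8 (- 4) 4) //.
rewrite (@DE 8 4 (- 4) (- 4)) //.
rewrite /kappa; ring.
Qed.

(** The constant term of y^a (-1)^d (h_2(y, 1/y, 1, -1) - 1) / (y - 1/y). *)
Definition weight_psi2 (a : int) (d : nat) : int := (-1) ^+ d * wtA a.

Lemma antisym_weight_psi2 (a : int) (d : nat) :
  \sum_(w : 'S_4) (-1) ^+ odd_perm w *
     weight_psi2 (a + ((w o1)%:Z - (w o0)%:Z)) (d + (3 - w o3))
  = 2 * ((-1) ^+ d * kappa a).
Proof.
pose U m := posodd (a + m%:Z - 5).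
pose D (m : nat) : int := (a + m%:Z - 4 == 0)%:R.
have UE m : U m.+2 = U m + D m by exact: posodd_shift.
pose F (i j k l : nat) : int := (-1) ^+ d * (-1) ^+ (3 - l) *
  (U (j + 7 - i)%N + U (j + 5 - i)%N + U (j + 3 - i)%N).
transitivity (\sum_(w : 'S_4) (-1) ^+ odd_perm w * F (w o0) (w o1) (w o2) (w o3)).
  apply: eq_bigr => w _; congr (_ * _); rewrite /F /weight_psi2 exprD /wtA /U.
  have := ltn_ord (w o0).
  move: (w o0 : nat) (w o1 : nat) (w o3 : nat) => i j l li.
  by congr (_ * (posodd _ + posodd _ + posodd _)); lia.
rewrite sum_S4 {}/F; cbv [addn subn Nat.add Nat.sub].
rewrite !UE /=.
have -> : kappa a = D 2%N + D 6%N - D 0%N - D 8%N.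
  by rewrite /kappa /D; congr ((nat_of_bool _)%:R + (nat_of_bool _)%:R - (nat_of_bool _)%:R - (nat_of_bool _)%:R); lia.
ring.
Qed.

(** * Coefficients as functions of parities and coincidences *)

(** For a strictly decreasing sequence x, the weights of x_i - x_j in terms of the
    parities p i of x_i and of the relations q i j expressing x_i = x_j + 1. *)
Section Tables.
Variables (p : nat -> bool) (q : nat -> nat -> bool).

Definition tabU i j : int := if (i < j)%N then (p i (+) p j)%:R else 0.
Definition tabA i j : int := if (i < j)%N then 3 * (p i (+) p j)%:R - (q i j)%:R else (q j i)%:R.
Definition tabB i j : int := if (i < j)%N then 2 * (p i (+) p j)%:R - (q i j)%:R else (q j i)%:R.
Definition tabC i j : int := if (i < j)%N then 2 * (~~ (p i (+) p j))%:R else 0.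

Definition tab_sq (i j k l : nat) : int :=
  tabA i l * tabU j k + tabU i l * tabB j k + tabC i l * tabC j k.
Definition tab_psi2 (i j k l : nat) : int := (-1) ^+ p l * tabA i j.
End Tables.

Lemma posodd_pos (x y : nat) : (y < x)%N -> posodd (x%:Z - y%:Z) = (odd x (+) odd y)%:R.
Proof.
move=> yx; rewrite /posodd.
have -> : `|x%:Z - y%:Z|%N = (x - y)%N by lia.
rewrite (oddB (ltnW yx)) (_ : 0 < x%:Z - y%:Z) //; lia.
Qed.

Lemma posodd_neg a : a <= 0 -> posodd a = 0.
Proof. by move=> a0; rewrite /posodd (_ : (0 < a) = false) //; lia. Qed.

Section Values.
Variables (x y : nat).
Hypothesis yx : (y < x)%N.

Lemma posodd_p2 : posodd (x%:Z - y%:Z + 2) = (odd x (+) odd y)%:R.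
Proof.
rewrite (_ : x%:Z - y%:Z + 2 = x.+2%:Z - y%:Z); last by lia.
by rewrite posodd_pos /= ?negbK //; lia.
Qed.

Lemma posodd_m2 : posodd (x%:Z - y%:Z - 2) = (odd x (+) odd y)%:R - (x == y.+1)%:R.
Proof.
have [->|xy] := eqVneq x y.+1.
  by rewrite posodd_neg /= ?addNb ?addbb //; lia.
have [xy2|xy2] := ltnP y.+2 x; last first.
  rewrite posodd_neg; last by lia.
  have -> : x = y.+2 by lia.
  by rewrite /= negbK addbb.
rewrite (_ : x%:Z - y%:Z - 2 = x%:Z - y.+2%:Z); last by lia.
by rewrite posodd_pos /= ?negbK ?subr0.
Qed.

Lemma posodd_n2 : posodd (y%:Z - x%:Z + 2) = (x == y.+1)%:R.
Proof.
have [->|xy] := eqVneq x y.+1; last by rewrite posodd_neg //; lia.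
by rewrite (_ : y%:Z - y.+1%:Z + 2 = 1) //; lia.
Qed.

Lemma posodd_p1 : posodd (x%:Z - y%:Z + 1) = (~~ (odd x (+) odd y))%:R.
Proof.
rewrite (_ : x%:Z - y%:Z + 1 = x.+1%:Z - y%:Z); last by lia.
by rewrite posodd_pos /= ?addNb //; lia.
Qed.

Lemma posodd_m1 : posodd (x%:Z - y%:Z - 1) = (~~ (odd x (+) odd y))%:R.
Proof.
have [->|xy] := eqVneq x y.+1.
  by rewrite posodd_neg /= ?addNb ?addbb //; lia.
rewrite (_ : x%:Z - y%:Z - 1 = x%:Z - y.+1%:Z); last by lia.
by rewrite posodd_pos /= ?addbN //; lia.
Qed.

Lemma wtA_pos : wtA (x%:Z - y%:Z) = 3 * (odd x (+) odd y)%:R - (x == y.+1)%:R.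
Proof. by rewrite /wtA posodd_p2 posodd_pos // posodd_m2; ring. Qed.

Lemma wtA_neg : wtA (y%:Z - x%:Z) = (x == y.+1)%:R.
Proof. by rewrite /wtA posodd_n2 !posodd_neg ?addr0 //; lia. Qed.

Lemma wtB_pos : wtB (x%:Z - y%:Z) = 2 * (odd x (+) odd y)%:R - (x == y.+1)%:R.
Proof. by rewrite /wtB posodd_p2 posodd_m2; ring. Qed.

Lemma wtB_neg : wtB (y%:Z - x%:Z) = (x == y.+1)%:R.
Proof. by rewrite /wtB posodd_n2 posodd_neg ?addr0 //; lia. Qed.

Lemma wtC_pos : wtC (x%:Z - y%:Z) = 2 * (~~ (odd x (+) odd y))%:R.
Proof. by rewrite /wtC posodd_p1 posodd_m1; ring. Qed.

Lemma wtC_neg : wtC (y%:Z - x%:Z) = 0.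
Proof. by rewrite /wtC !posodd_neg ?addr0 //; lia. Qed.
End Values.

(** b0, .., b3 tell which of four decreasing parts are odd, and e01, e12, e23
    which consecutive parts coincide; d(lam) - 1 = 3 - e01 - e12 - e23. *)
Definition all_even_coef (b0 b1 b2 b3 e01 e12 e23 : bool) : int :=
  if [&& ~~ b0, ~~ b1, ~~ b2 & ~~ b3] then 3 - e01%:R - e12%:R - e23%:R else 0.

(** Equal odd parts of a decreasing sequence are consecutive if there are only
    two odd parts, as the parts between them would be equal to them. *)
Definition mixed_coef (b0 b1 b2 b3 e01 e12 e23 : bool) : int :=
  ((b0 + b1 + b2 + b3 == 2)%N &&
   ~~ [|| [&& e01, b0 & b1], [&& e12, b1 & b2] | [&& e23, b2 & b3]])%:R.

Definition coef b0 b1 b2 b3 e01 e12 e23 :=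
  all_even_coef b0 b1 b2 b3 e01 e12 e23 + mixed_coef b0 b1 b2 b3 e01 e12 e23.

Section SmallCases.
Variables (b0 b1 b2 b3 e01 e12 e23 : bool).
(* The parities of the parts shifted by delta = (3, 2, 1, 0). *)
Let p i := nth false [:: ~~ b0; b1; ~~ b2; b3] i.
Let q i j := (j == i.+1)%N && nth false [:: e01; e12; e23] i.
Hypotheses (h01 : e01 ==> (b0 == b1)) (h12 : e12 ==> (b1 == b2)) (h23 : e23 ==> (b2 == b3)).
Hypothesis even_sum : ~~ (b0 (+) b1 (+) b2 (+) b3).

Lemma sum_tab_sq :
  \sum_(w : 'S_4) (-1) ^+ odd_perm w * tab_sq p q (w o0) (w o1) (w o2) (w o3) =
  4 * (coef b0 b1 b2 b3 e01 e12 e23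
       + coef (~~ b0) (~~ b1) (~~ b2) (~~ b3) e01 e12 e23).
Proof.
rewrite sum_S4; move: h01 h12 h23 even_sum; rewrite /p /q.
case: b0; case: b1; case: b2; case: b3 => //; case: e01 => //; case: e12 => //;
  case: e23 => // _ _ _ _; vm_compute; reflexivity.
Qed.

Lemma sum_tab_psi2 :
  \sum_(w : 'S_4) (-1) ^+ odd_perm w * tab_psi2 p q (w o0) (w o1) (w o2) (w o3) =
  4 * (coef b0 b1 b2 b3 e01 e12 e23
       - coef (~~ b0) (~~ b1) (~~ b2) (~~ b3) e01 e12 e23).
Proof.
rewrite sum_S4; move: h01 h12 h23 even_sum; rewrite /p /q.
case: b0; case: b1; case: b2; case: b3 => //; case: e01 => //; case: e12 => //;
  case: e23 => // _ _ _ _; vm_compute; reflexivity.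
Qed.
End SmallCases.

(** * The two-row character on g and on its square *)

(** The sum of products is the trace of g times the n-th tensor power of A B, and
    the trace of a product is cyclic. *)
Lemma cyclic_trace n (R : comPzRingType) (g : 'S_n) (T1 T2 : finType)
    (A : T1 -> T2 -> R) (B : T2 -> T1 -> R) :
  \sum_(F : {ffun 'I_n -> T1}) \prod_i \sum_k A (F i) k * B k (F (g i)) =
  \sum_(K : {ffun 'I_n -> T2}) \prod_i \sum_p B (K i) p * A p (K (g i)).
Proof.
under eq_bigr do rewrite bigA_distr_bigA.
under [RHS]eq_bigr do rewrite bigA_distr_bigA.
rewrite exchange_big /=; apply: eq_bigr => K _.
pose sh (g : 'S_n) (F : {ffun 'I_n -> T1}) := [ffun i => F (g i)].
rewrite [RHS](reindex (sh g)) /=; last first.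
  by exists (sh (g^-1)%g) => F _; apply/ffunP => i; rewrite !ffunE (permK, permKV).
apply: eq_bigr => F _; rewrite !big_split /= mulrC; congr (_ * _).
  by apply: eq_bigr => i _; rewrite ffunE.
by rewrite (reindex_inj (@perm_inj _ g)); apply: eq_bigr => i _; rewrite ffunE.
Qed.

Definition two_row (k : nat) (v : 'I_2) : nat := nth 0%N [:: (k + 1)%N; (k - 1)%N] v.

Lemma forall_ord2 (P : pred 'I_2) : [forall i, P i] = P ord0 && P (lift ord0 ord0).
Proof.
apply/forallP/andP => [H|[H0 H1] i]; first by rewrite !H.
by case: (unliftP ord0 i) => [j ->|-> //]; rewrite (ord1 j).
Qed.

Lemma jt_coef_two_row k n (c : 'I_2 -> nat) : (0 < k)%N -> n = (2 * k)%N ->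
  (\sum_v c v = n)%N ->
  jt_coef (two_row k) c = ((c ord0)%:Z - (c (lift ord0 ord0))%:Z == 2)%:R
                   - ((c ord0)%:Z - (c (lift ord0 ord0))%:Z == 4)%:R.
Proof.
move=> k0 nk; rewrite !big_ord_recl big_ord0 addn0 => sum_c.
rewrite /jt_coef sum_perm_recl; under eq_bigr do rewrite sum_perm_recl.
under eq_bigr do under eq_bigr do
  rewrite sum_perm0 !odd_lift_perm odd_perm1 forall_ord2 !(lift_perm_id, lift_perm_lift).
rewrite !big_ord_recl !big_ord0 /beta /two_row /= /bump /=.
rewrite !addr0 mul1r mulN1r; congr (_%:R - _%:R); congr (nat_of_bool _); lia.
Qed.

(** Averages over the exchange of the two letters. *)
Lemma two_row_kappa k n (g : 'S_n) : (0 < k)%N -> n = (2 * k)%N ->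
  2 * jt_char (two_row k) g =
  \sum_(h : {ffun 'I_n -> bool} | fixes g h)
     kappa ((content h true)%:Z - (content h false)%:Z).
Proof.
move=> k0 nk; pose K (c : 'I_2 -> nat) : int :=
  ((c ord0)%:Z - (c (lift ord0 ord0))%:Z == 2)%:R
  - ((c ord0)%:Z - (c (lift ord0 ord0))%:Z == 4)%:R.
have KE c c' : c =1 c' -> K c = K c' by move=> e; rewrite /K !e.
have -> : jt_char (two_row k) g = \sum_(f : {ffun 'I_n -> 'I_2} | fixes g f) K (content f).
  by apply: eq_bigr => f _; apply: (jt_coef_two_row k0 nk); apply: sum_content.
pose b2o (b : bool) : 'I_2 := if b then ord0 else lift ord0 ord0.
pose o2b (i : 'I_2) := i == ord0.
have b2oK : cancel b2o o2b by case.
have o2bK : cancel o2b b2o.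
  by move=> i; case: (unliftP ord0 i) => [j ->|-> //]; rewrite (ord1 j).
rewrite -[2]/(1 + 1) mulrDl mul1r {1}(sum_fixes_relabel _ KE b2oK o2bK).
have nK : cancel (b2o \o negb) (negb \o o2b) by move=> b; rewrite /= b2oK negbK.
have nK' : cancel (negb \o o2b) (b2o \o negb) by move=> i; rewrite /= negbK o2bK.
rewrite (sum_fixes_relabel _ KE nK nK') -big_split; apply: eq_bigr => h _ /=.
rewrite /K /o2b /=; set c := content h true; set c' := content h false.
have flip e : (c'%:Z - c%:Z == e) = (c%:Z - c'%:Z == - e) by lia.
by rewrite /kappa !flip; ring.
Qed.

Lemma sum_ord4 (d : 'I_4 -> nat) : (\sum_v d v = d o0 + d o1 + d o2 + d o3)%N.
Proof. by rewrite !big_ord_recl big_ord0 addn0 !addnA. Qed.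

Lemma prod_ord4 (R : pzRingType) (d : 'I_4 -> R) : \prod_v d v = d o0 * d o1 * d o2 * d o3.
Proof. by rewrite !big_ord_recl big_ord0 mulr1 !mulrA. Qed.

(** A pair of two-letter functions is a function with four letters, in the order
    tu, t/u, u/t, 1/(tu). *)
Definition cell4 (p : bool * bool) : 'I_4 :=
  match p with
  | (true, true) => o0 | (true, false) => o1 | (false, true) => o2 | (false, false) => o3
  end.

Definition uncell4 (i : 'I_4) : bool * bool := ((i < 2)%N, ~~ odd i).

Lemma cell4K : cancel cell4 uncell4.
Proof. by case=> [[] []]. Qed.

Lemma uncell4K : cancel uncell4 cell4.
Proof. by case=> [[|[|[|[|m]]]] lt_m] //; apply: val_inj. Qed.

Lemma two_row_sq k n (g : 'S_n) : (0 < k)%N -> n = (2 * k)%N ->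
  4 * jt_char (two_row k) g ^+ 2 =
  \sum_(f : {ffun 'I_n -> 'I_4} | fixes g f)
     kappa ((content f o0)%:Z - (content f o3)%:Z + ((content f o1)%:Z - (content f o2)%:Z))
     * kappa ((content f o0)%:Z - (content f o3)%:Z - ((content f o1)%:Z - (content f o2)%:Z)).
Proof.
move=> k0 nk; have -> : 4 * jt_char (two_row k) g ^+ 2 = (2 * jt_char (two_row k) g) * (2 * jt_char (two_row k) g) by ring.
rewrite (two_row_kappa _ k0 nk) mulr_suml.
under eq_bigr do rewrite mulr_sumr.
pose H (x y : bool -> nat) := kappa ((x true)%:Z - (x false)%:Z) * kappa ((y true)%:Z - (y false)%:Z).
have HE x x' y y' : x =1 x' -> y =1 y' -> H x y = H x' y' by move=> ex ey; rewrite /H !ex !ey.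
rewrite (sum_fixes_pair _ HE).
pose K (c : bool * bool -> nat) := H (fun t => \sum_s c (t, s))%N (fun s => \sum_t c (t, s))%N.
have KE c c' : c =1 c' -> K c = K c'.
  by move=> e; apply: HE => t; apply: eq_bigr => s _; rewrite e.
have KC (c : 'I_4 -> nat) : K (fun p => c (cell4 p)) =
    kappa ((c o0)%:Z - (c o3)%:Z + ((c o1)%:Z - (c o2)%:Z))
    * kappa ((c o0)%:Z - (c o3)%:Z - ((c o1)%:Z - (c o2)%:Z)).
  by rewrite /K /H !big_bool /=; congr (kappa _ * kappa _); lia.
by rewrite (sum_fixes_relabel _ KE uncell4K cell4K); apply: eq_bigr => f _; apply: KC.
Qed.

Lemma prod_content n (R : comPzRingType) (T : finType) (d : T -> R) (f : {ffun 'I_n -> T}) :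
  \prod_i d (f i) = \prod_t d t ^+ content f t.
Proof.
rewrite (partition_big f predT) //=; apply: eq_bigr => t _.
rewrite (eq_bigr (fun=> d t)) => [|i /eqP -> //].
by rewrite prodr_const; congr (_ ^+ _); apply: eq_card.
Qed.

(** The exchange of the two factors of C^2 (x) C^2, graded by the number of true
    letters, is eigA diag(eigD) eigA^(-1); the columns of eigA are the symmetric
    vectors e_tt, e_ff, e_tf + e_ft and the antisymmetric vector e_tf - e_ft. *)
Definition eigA (p : bool * bool) (k : 'I_4) : {poly rat} :=
  match p with
  | (true, true) => [:: 1; 0; 0; 0] | (false, false) => [:: 0; 1; 0; 0]
  | (true, false) => [:: 0; 0; 1; 1] | (false, true) => [:: 0; 0; 1; - 1]
  end`_k.

Definition eigD (k : 'I_4) : {poly rat} := [:: 'X^2; 1; 'X; - 'X]`_k.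

(** diag(eigD) eigA^(-1): the last two columns of eigA have squared norm 2. *)
Definition eigB (k : 'I_4) (p : bool * bool) : {poly rat} :=
  eigD k * (if (k < 2)%N then 1 else (2^-1)%:P) * eigA p k.

Lemma eigAB p q : \sum_k eigA p k * eigB k q =
  if q == (p.2, p.1) then 'X^(p.1 + p.2) else 0.
Proof.
have h2 : (2^-1)%:P + (2^-1)%:P = 1 :> {poly rat} by rewrite -polyCD.
rewrite !big_ord_recl big_ord0 /eigB /eigD /eigA.
have hX : 'X * (2^-1)%:P + 'X * (2^-1)%:P = 'X :> {poly rat} by rewrite -mulrDr h2 mulr1.
by case: p q => [[] []] [[] []] /=; rewrite ?expr0 ?expr1 -?[RHS]hX; ring.
Qed.

Lemma eigBA k l : \sum_p eigB k p * eigA p l = if l == k then eigD k else 0.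
Proof.
have h2 : (2^-1)%:P + (2^-1)%:P = 1 :> {poly rat} by rewrite -polyCD.
have hX : 'X * (2^-1)%:P + 'X * (2^-1)%:P = 'X :> {poly rat} by rewrite -mulrDr h2 mulr1.
have pairE (F : bool * bool -> {poly rat}) : \sum_p F p = \sum_a \sum_b F (a, b).
  by rewrite pair_big /=; apply: eq_bigr => -[].
rewrite pairE !big_bool /eigB /eigD /eigA.
case: k l => [[|[|[|[|k]]]] lt_k] // [[|[|[|[|l]]]] lt_l] //=; rewrite -?val_eqE /=; first [ring | rewrite -[in RHS]hX; ring].
Qed.

(** A function h fixed by g^2 is the pair (h, h o g), which g maps to its exchange;
    so these functions are counted by the trace of g composed with the exchange,
    and diagonalizing the exchange leaves functions with four letters fixed by g,
    with a sign for each occurrence of the antisymmetric vector. *)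
Lemma two_row_psi2 k n (g : 'S_n) : (0 < k)%N -> n = (2 * k)%N ->
  2 * jt_char (two_row k) (g * g)%g =
  \sum_(f : {ffun 'I_n -> 'I_4} | fixes g f)
     (-1) ^+ content f o3 * kappa ((content f o0)%:Z - (content f o1)%:Z).
Proof.
move=> k0 nk; rewrite (two_row_kappa _ k0 nk).
(* 'X records the number of true letters; L reads off kappa from its powers. *)
pose L (p : {poly rat}) : rat := \sum_(m < (2 * n).+1) (kappa (m%:Z - n%:Z))%:~R * p`_m.
have LX a : (a <= 2 * n)%N -> L 'X^a = (kappa (a%:Z - n%:Z))%:~R.
  move=> le_a; rewrite /L (bigD1 (Ordinal (le_a : (a < (2 * n).+1)%N))) //= coefXn eqxx mulr1.
  by rewrite big1 ?addr0 // => m; rewrite -val_eqE coefXn /= => /negbTE ->; rewrite mulr0.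
have LD I (P : pred I) (s : seq I) F : L (\sum_(i <- s | P i) F i) = \sum_(i <- s | P i) L (F i).
  rewrite /L exchange_big /=; apply: eq_bigr => m _; by rewrite coef_sum mulr_sumr.
have LZ (e : nat) p : L ((-1) ^+ e * p) = (-1) ^+ e * L p.
  by rewrite -signr_odd -[in RHS]signr_odd; case: (odd e);
     rewrite ?mulN1r ?mul1r // /L -sumrN; apply: eq_bigr => m _; rewrite coefN mulrN.
have := cyclic_trace g eigA eigB; move/(congr1 L).
under eq_bigr do under eq_bigr do rewrite eigAB.
under [in X in _ = X -> _]eq_bigr do under eq_bigr do rewrite eigBA.
have sum2 (c : {ffun 'I_n -> bool}) : (content c true + content c false = n)%N.
  by rewrite -[RHS](sum_content c) big_bool.
have sum4 (c : {ffun 'I_n -> 'I_4}) : (content c o0 + content c o1 + content c o2 + content c o3 = n)%N.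
  by rewrite -[RHS](sum_content c) sum_ord4.
have prod_if (T : finType) (P : pred 'I_n) (F : 'I_n -> {poly rat}) :
    \prod_i (if P i then F i else 0) = if [forall i, P i] then \prod_i F i else 0.
  case: ifPn => [/forallP Pt|/forallPn [i /negbTE Pi]].
    by apply: eq_bigr => i _; rewrite Pt.
  by rewrite (bigD1 i) //= Pi mul0r.
under eq_bigr do rewrite (prod_if bool).
under [in X in _ = X -> _]eq_bigr do rewrite (prod_if bool).
rewrite -!big_mkcond /= => trE; apply: (@intr_inj rat).
rewrite !intr_sum; transitivity (L (\sum_(F : {ffun 'I_n -> bool * bool}
     | [forall i, F (g i) == ((F i).2, (F i).1)]) \prod_i 'X^((F i).1 + (F i).2))).
  pose tr (h : {ffun 'I_n -> bool}) : {ffun 'I_n -> bool * bool} := [ffun i => (h i, h (g i))].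
  pose tr' (F : {ffun 'I_n -> bool * bool}) : {ffun 'I_n -> bool} := [ffun i => (F i).1].
  rewrite LD [RHS](reindex_onto tr tr') => [|F /'forall_eqP FE]; last first.
    by apply/ffunP => i; rewrite !ffunE FE /=; case: (F i).
  have trK h : tr' (tr h) = h by apply/ffunP => i; rewrite !ffunE.
  apply: eq_big => [h|h _].
    rewrite trK eqxx andbT; apply/fixesP/'forall_eqP => hg i.
      by rewrite !ffunE /= -(hg i) permM.
    by have := hg i; rewrite !ffunE /= permM => -[].
  have -> : \prod_i 'X^((tr h i).1 + (tr h i).2) = 'X^(2 * content h true) :> {poly rat}.
    rewrite -(big_morph _ (exprD 'X) (expr0 'X)); congr ('X^_).
    have cE : (\sum_i h i = content h true)%N.
      by rewrite /content -sum1_card [RHS]big_mkcond /=; apply: eq_bigr => i _; rewrite !inE; case: (h i).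
    rewrite mul2n -addnn -{1}cE -cE [X in (_ + X)%N](reindex_inj (@perm_inj _ g)) -big_split.
    by apply: eq_bigr => i _; rewrite ffunE.
  have := sum2 h; move: (content h true) (content h false) => c c' cc.
  by rewrite LX; [congr (kappa _)%:~R|]; lia.
rewrite trE LD; apply: eq_bigr => f _.
rewrite prod_content; have := sum4 f; move: (content f) => c cc.
have -> : \prod_t eigD t ^+ c t = (-1) ^+ c o3 * 'X^(2 * c o0 + c o2 + c o3).
  rewrite prod_ord4 /eigD /= expr1n mulr1 -exprM (exprNn ('X : {poly rat})).
  by rewrite [RHS]mulrC mulrCA mulrC -!exprD mulrC.
rewrite LZ LX; last by lia.
by rewrite rmorphM rmorph_sign; congr (_ * (kappa _)%:~R); lia.
Qed.

(** * Expansion of antisymmetric sums in Jacobi-Trudi characters *)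

Lemma sort_perm r (x : 'I_r -> nat) :
  exists w : 'S_r, forall i k : 'I_r, (i <= k)%N -> (x (w k) <= x (w i))%N.
Proof.
pose tx := [tuple x i | i < r].
have /tuple_permP [w wE] : perm_eq (sort geq tx) tx by rewrite perm_sort.
exists w => i k ik.
have nthE (j : 'I_r) : nth 0%N (sort geq tx) j = x (w j).
  have := tnth_nth 0%N [tuple tnth tx (w i) | i < r] j.
  by rewrite -wE => <-; rewrite !tnth_mktuple.
rewrite -!nthE; apply: (sorted_leq_nth (leT := geq)) => //.
- exact: rev_trans leq_trans.
- exact: leqnn.
- by apply: sort_sorted => a b; exact: leq_total.
- by rewrite inE size_sort size_tuple.
- by rewrite inE size_sort size_tuple.
Qed.

Lemma strict_dec_perm r (x y : 'I_r -> nat) (t : 'S_r) :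
  (forall i k : 'I_r, (i < k)%N -> (x k < x i)%N) ->
  (forall i k : 'I_r, (i < k)%N -> (y k < y i)%N) ->
  x =1 y \o t -> t = 1%g.
Proof.
move=> xd yd xy.
have mono (i k : 'I_r) : (t i < t k)%N = (i < k)%N.
  have [ik|ki|/val_inj ->] := ltngtP i k; last by rewrite ltnn.
    case: (ltngtP (t i) (t k)) (xd _ _ ik) => //; rewrite !xy /=.
      by move=> /yd; case: ltngtP.
    by move=> /val_inj ->; rewrite ltnn.
  case: (ltngtP (t i) (t k)) (xd _ _ ki) => //; rewrite !xy /=.
  by move=> /yd; case: ltngtP.
have below_card (i : 'I_r) : #|[set k : 'I_r | (k < i)%N]| = i.
  rewrite -[RHS]card_ord -(card_imset _ (widen_ord_injective (le_mp := ltnW (ltn_ord i)))).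
  apply: eq_card => k; rewrite inE; apply/idP/imsetP => [ki|[j _ ->] //=].
  by exists (Ordinal ki) => //; apply: val_inj.
apply/permP => i; rewrite perm1; apply: val_inj.
rewrite -[LHS]below_card -[RHS]below_card -[RHS](card_imset _ (@perm_inj _ t)).
apply: eq_card => k; rewrite inE; apply/idP/imsetP => [ki|[j]]; last first.
  by rewrite inE => ji ->; rewrite mono.
by exists ((t^-1)%g k); rewrite ?permKV // inE -mono permKV.
Qed.

Definition part n (l : 4.-tuple 'I_n.+1) (v : 'I_4) : nat := nth 0%N (parts l) v.

Lemma part_tnth n (l : 4.-tuple 'I_n.+1) v : part l v = tnth l v.
Proof. by rewrite /part /parts (nth_map (tnth l v)) ?size_tuple // -tnth_nth. Qed.

Lemma P4_dec n (l : 4.-tuple 'I_n.+1) : l \in P4 n ->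
  (forall i k : 'I_4, (i <= k)%N -> (part l k <= part l i)%N) /\ (\sum_v part l v = n)%N.
Proof.
rewrite inE => /andP [sl /eqP suml]; split; first by move=> i k; apply: nth_dec.
rewrite -[RHS]suml sumnE /parts big_map big_tuple.
by apply: eq_bigr => v _; rewrite part_tnth.
Qed.

Lemma P4_exists n (lam : 'I_4 -> nat) :
  (forall i k : 'I_4, (i <= k)%N -> (lam k <= lam i)%N) -> (\sum_v lam v = n)%N ->
  exists2 l : 4.-tuple 'I_n.+1, l \in P4 n & part l =1 lam.
Proof.
move=> dec sum_lam; pose l : 4.-tuple 'I_n.+1 := [tuple inord (lam i) | i < 4].
have lE : part l =1 lam.
  move=> v; rewrite part_tnth tnth_mktuple inordK // ltnS -sum_lam (bigD1 v) //=.
  exact: leq_addr.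
exists l => //; rewrite inE; apply/andP; split.
  apply/(sortedP 0%N) => i; rewrite size_map size_tuple => lt_i.
  have := dec (Ordinal (ltnW lt_i)) (Ordinal lt_i) (leqnSn i).
  by rewrite -!lE.
rewrite -[eqbRHS]sum_lam sumnE /parts big_map big_tuple; apply/eqP.
by apply: eq_bigr => v _; rewrite -lE part_tnth.
Qed.

Lemma part_inj n (l l' : 4.-tuple 'I_n.+1) : part l =1 part l' -> l = l'.
Proof.
move=> e; apply: eq_from_tnth => v; apply: val_inj.
by have := e v; rewrite !part_tnth.
Qed.

(** An antisymmetric function vanishes at arguments with repeated entries, and
    other arguments are a rearrangement of lam + delta for a unique partition. *)
Lemma alternating_expansion n (Gam : ('I_4 -> nat) -> int) (c : 'I_4 -> nat) :
  (forall x y, x =1 y -> Gam x = Gam y) ->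
  (forall x (t : 'S_4), Gam (x \o t) = (-1) ^+ odd_perm t * Gam x) ->
  (\sum_v c v = n)%N ->
  Gam (beta c) = \sum_(l in P4 n) Gam (beta (part l)) * rearr_sign (beta (part l)) (beta c).
Proof.
move=> eqG antiG sum_c.
have Gam0 : Gam (beta c) = 0 \/ injective (beta c).
  have [/injectiveP|/injectivePn [i [k ik e]]] := boolP (injectiveb (beta c)); first by right.
  left; have := antiG (beta c) (tperm i k); rewrite odd_tperm ik expr1 mulN1r.
  rewrite (eqG _ (beta c)); first by lia.
  by move=> j /=; case: tpermP => [->|->|].
case: Gam0 => [Gam0|c_inj].
  rewrite Gam0 big1 // => l lP; rewrite /rearr_sign mulr_sumr big1 // => w _.
  case: forallP => [e|_]; last by rewrite !mulr0.
  have := antiG (beta (part l)) w; rewrite -(eqG (beta c)) => [|i]; last exact/eqP/e.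
  rewrite Gam0 => /esym /eqP; rewrite mulf_eq0 signr_eq0 /= => /eqP ->.
  by rewrite mul0r.
have [w0 w0E] := sort_perm (beta c).
have strict (i k : 'I_4) : (i < k)%N -> (beta c (w0 k) < beta c (w0 i))%N.
  move=> ik; rewrite ltn_neqAle w0E ?(ltnW ik) // andbT; apply/eqP => /c_inj /perm_inj e.
  by rewrite e ltnn in ik.
have step (i k : 'I_4) : (i <= k)%N -> (beta c (w0 k) + (k - i) <= beta c (w0 i))%N.
  move=> ik; have [d kd] : exists d, (k = i + d :> nat)%N by exists (k - i)%N; lia.
  elim: d k kd ik => [|d IH] k kd ik; first by rewrite (val_inj (_ : k = i :> nat)); lia.
  have lt_d : (i + d < 4)%N by have := ltn_ord k; lia.
  have := IH (Ordinal lt_d) erefl (leq_addr _ _).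
  have := strict (Ordinal lt_d) k; rewrite /= kd; lia.
pose lam (i : 'I_4) := (beta c (w0 i) - rev_ord i)%N.
have ge_rev (i : 'I_4) : (rev_ord i <= beta c (w0 i))%N.
  have /= := step i o3; have := ltn_ord i; rewrite /bump /=; lia.
have lamE (i : 'I_4) : (beta lam i = beta c (w0 i))%N by rewrite {1}/beta subnK.
have dec_lam (i k : 'I_4) : (i <= k)%N -> (lam k <= lam i)%N.
  move=> ik; have := step i k ik; rewrite /lam /=; have := ltn_ord k; lia.
have sum_lam : (\sum_v lam v = n)%N.
  have : (\sum_v beta lam v = \sum_v beta c v)%N.
    by rewrite [RHS](reindex_inj (@perm_inj _ w0)); apply: eq_bigr => v _; rewrite lamE.
  by rewrite /beta !big_split /= => /addIn ->.
have [l0 l0P l0E] := P4_exists dec_lam sum_lam.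
have bl0 i : beta (part l0) i = beta c (w0 i) by rewrite -lamE /beta l0E.
have bl0V i : beta c i = beta (part l0) ((w0^-1)%g i) by rewrite bl0 permKV.
have key l (w : 'S_4) : l \in P4 n -> (forall i, beta c i = beta (part l) (w i)) -> l = l0 /\ (w = w0^-1)%g.
  move=> lP e; have [decl _] := P4_dec lP.
  have e1 : (w0 * w = 1)%g.
    apply: (@strict_dec_perm _ (beta lam) (beta (part l))) => [||i].
    - exact: beta_dec.
    - exact: beta_dec.
    - by rewrite lamE e /= permM.
  split; last by apply/eqP; rewrite eq_sym eq_invg_mul e1.
  apply: part_inj => i; rewrite l0E; apply: (@addIn (rev_ord i)).
  by rewrite -/(beta _ i) -/(beta lam i) lamE e -permM e1 perm1.
rewrite (bigD1 l0) //= [X in _ + X]big1 ?addr0 => [|l /andP [lP l_neq]]; last first.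
  rewrite /rearr_sign big1 ?mulr0 // => w _; case: forallP => [e|_]; last by rewrite mulr0.
  by case/eqP: l_neq; case: (key l w lP (fun i => eqP (e i))).
have -> : rearr_sign (beta (part l0)) (beta c) = (-1) ^+ odd_perm w0.
  rewrite /rearr_sign (bigD1 (w0^-1)%g) //= [X in _ + X]big1 ?addr0 => [|w w_neq].
    by case: forallP => [_|[] i]; [rewrite mulr1 odd_permV | rewrite bl0V].
  case: forallP => [e|_]; last by rewrite mulr0.
  by case/eqP: w_neq; case: (key l0 w l0P (fun i => eqP (e i))).
by rewrite mulrC -odd_permV -antiG; apply: eqG => i; rewrite bl0V.
Qed.

(** Multiplication of p_g by a_delta and expansion in alternants. *)
Lemma sum_fixes_antisym n (g : 'S_n) (G : ('I_4 -> nat) -> int) :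
  (forall x y, x =1 y -> G x = G y) ->
  \sum_(f : {ffun 'I_n -> 'I_4} | fixes g f) \sum_(w : 'S_4)
     (-1) ^+ odd_perm w * G (fun i => content f i + rev_ord (w i))%N =
  \sum_(l in P4 n)
     (\sum_(w : 'S_4) (-1) ^+ odd_perm w * G (beta (part l) \o w)) * jt_char (part l) g.
Proof.
move=> eqG; pose Gam (x : 'I_4 -> nat) := \sum_(w : 'S_4) (-1) ^+ odd_perm w * G (x \o w).
have eqGam x y : x =1 y -> Gam x = Gam y.
  by move=> xy; apply: eq_bigr => w _; congr (_ * _); apply: eqG => i /=; apply: xy.
have antiGam x (t : 'S_4) : Gam (x \o t) = (-1) ^+ odd_perm t * Gam x.
  rewrite /Gam mulr_sumr [RHS](reindex_inj (mulIg t)); apply: eq_bigr => w _.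
  rewrite odd_permM addbC signr_addb mulrA mulrA -signr_addb addbb mul1r.
  by congr (_ * _); apply: eqG => i; rewrite /= permM.
transitivity (\sum_(f : {ffun 'I_n -> 'I_4} | fixes g f) Gam (beta (content f))).
  rewrite exchange_big [RHS]exchange_big /=; apply: eq_bigr => w _.
  pose H (c : 'I_4 -> nat) := (-1) ^+ odd_perm w * G (fun i => c i + rev_ord (w i))%N.
  have eqH x y : x =1 y -> H x = H y.
    by move=> xy; congr (_ * _); apply: eqG => i; rewrite xy.
  exact: (sum_fixes_perm _ w eqH).
transitivity (\sum_(f : {ffun 'I_n -> 'I_4} | fixes g f) \sum_(l in P4 n)
    Gam (beta (part l)) * rearr_sign (beta (part l)) (beta (content f))).
  apply: eq_bigr => f _; apply: alternating_expansion => //; exact: sum_content.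
by rewrite exchange_big; apply: eq_bigr => l _; rewrite -mulr_sumr jt_charE.
Qed.

(** * The decomposition of the symmetric and alternating squares *)

Section Parts.
Variables (n : nat) (l : 4.-tuple 'I_n.+1).
Hypothesis lP : l \in P4 n.
Local Notation a := (part l o0).
Local Notation b := (part l o1).
Local Notation c := (part l o2).
Local Notation d := (part l o3).

(** s = true exchanges the roles of odd and even parts. *)
Definition coef_of (s : bool) :=
  coef (s (+) odd a) (s (+) odd b) (s (+) odd c) (s (+) odd d) (a == b) (b == c) (c == d).

Lemma partsE : parts l = [:: a; b; c; d].
Proof.
apply: (@eq_from_nth _ 0%N) => [|i]; first by rewrite size_map size_tuple.
by rewrite size_map size_tuple; case: i => [|[|[|[|i]]]].
Qed.

Lemma part_ge : [/\ (b <= a)%N, (c <= b)%N & (d <= c)%N].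
Proof. by have [dec _] := P4_dec lP; split; apply: dec. Qed.

Lemma size_undup_parts : ndistinct l = (4 - (a == b) - (b == c) - (c == d))%N.
Proof.
have [ba cb dc] := part_ge; rewrite /ndistinct partsE /= !inE.
by case: eqP => ab; case: eqP => bc; case: eqP => cd; case: eqP => ac; case: eqP => bd;
   case: eqP => ad /=; lia.
Qed.

Lemma coef_even : coef_of false =
  (l \in E4 n)%:R * ((ndistinct l)%:R - 1) + (l \in E2O2' n)%:R.
Proof.
have [ba cb dc] := part_ge.
rewrite [l \in E4 n]inE [l \in E2O2' n]inE lP /= size_undup_parts.
rewrite /even_parts /odd_parts partsE /coef_of /coef /all_even_coef /mixed_coef /=.
case oa: (odd a); case ob: (odd b); case oc: (odd c); case od: (odd d);
  rewrite /= ?inE ?andbT ?andbF ?orbF ?mul0r ?mul1r ?addr0 ?add0r //=.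
all: try (congr (nat_of_bool _)%:R; lia).
all: try lia.
Qed.

Lemma coef_odd : coef_of true =
  (l \in O4 n)%:R * ((ndistinct l)%:R - 1) + (l \in E2'O2 n)%:R.
Proof.
have [ba cb dc] := part_ge.
rewrite [l \in O4 n]inE [l \in E2'O2 n]inE lP /= size_undup_parts.
rewrite /even_parts /odd_parts partsE /coef_of /coef /all_even_coef /mixed_coef /=.
case oa: (odd a); case ob: (odd b); case oc: (odd c); case od: (odd d);
  rewrite /= ?inE ?andbT ?andbF ?orbF ?mul0r ?mul1r ?addr0 ?add0r //=.
all: try (congr (nat_of_bool _)%:R; lia).
all: try lia.
Qed.

Hypothesis even_n : ~~ odd n.

Let p i := nth false [:: ~~ odd a; odd b; ~~ odd c; odd d] i.
Let q i j := (j == i.+1)%N && nth false [:: a == b; b == c; c == d] i.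

Lemma beta_parity (i : 'I_4) : odd (beta (part l) i) = p i.
Proof.
case: i => [[|[|[|[|i]]]] lt_i] //=; rewrite /beta oddD /=.
- by rewrite addbT; congr (~~ odd (part l _)); apply: val_inj.
- by rewrite addbF; congr (odd (part l _)); apply: val_inj.
- by rewrite addbT; congr (~~ odd (part l _)); apply: val_inj.
- by rewrite addbF; congr (odd (part l _)); apply: val_inj.
Qed.

Lemma beta_gap (i j : 'I_4) : (i < j)%N ->
  (beta (part l) i == (beta (part l) j).+1) = q i j.
Proof.
have [ba cb dc] := part_ge.
have bE (m : 'I_4) : beta (part l) m = (nth 0 [:: a; b; c; d] m + (3 - m))%N.
  by rewrite -partsE.
rewrite !bE /q; case: i j => [[|[|[|[|i]]]] lt_i] // [[|[|[|[|j]]]] lt_j] //= _; lia.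
Qed.

Lemma beta_part_dec (i j : 'I_4) : (i < j)%N -> (beta (part l) j < beta (part l) i)%N.
Proof. by apply: beta_dec; have [] := P4_dec lP. Qed.

Lemma wt_tab (i j : 'I_4) : i != j ->
  let x := beta (part l) in
  [/\ wtA ((x i)%:Z - (x j)%:Z) = tabA p q i j,
      wtB ((x i)%:Z - (x j)%:Z) = tabB p q i j,
      wtC ((x i)%:Z - (x j)%:Z) = tabC p i j &
      posodd ((x i)%:Z - (x j)%:Z) = tabU p i j].
Proof.
move=> ij /=; rewrite /tabA /tabB /tabC /tabU -!beta_parity.
case: (ltngtP i j) => [lt_ij|lt_ji|/val_inj e]; last by rewrite e eqxx in ij.
  have gt := beta_part_dec lt_ij; rewrite -beta_gap //.
  by rewrite wtA_pos ?wtB_pos ?wtC_pos ?posodd_pos.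
have gt := beta_part_dec lt_ji; rewrite -beta_gap //.
by rewrite wtA_neg ?wtB_neg ?wtC_neg ?posodd_neg //; lia.
Qed.

Lemma part_gaps : [/\ (a == b) ==> (odd a == odd b), (b == c) ==> (odd b == odd c)
  & (c == d) ==> (odd c == odd d)].
Proof. by split; apply/implyP => /eqP ->. Qed.

Lemma part_parity : ~~ (odd a (+) odd b (+) odd c (+) odd d).
Proof.
by have [_] := P4_dec lP; rewrite sum_ord4 -!oddD => ->.
Qed.

(** All differences of entries of lam + delta are covered by the tables. *)
Lemma weight_sq_coef :
  \sum_(w : 'S_4) (-1) ^+ odd_perm w *
    weight_sq ((beta (part l) (w o0))%:Z - (beta (part l) (w o3))%:Z)
          ((beta (part l) (w o1))%:Z - (beta (part l) (w o2))%:Z) =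
  4 * (coef_of false + coef_of true).
Proof.
have [g1 g2 g3] := part_gaps.
rewrite /coef_of !addFb !addTb -(sum_tab_sq g1 g2 g3 part_parity).
apply: eq_bigr => w _; congr (_ * _); rewrite /weight_sq /tab_sq.
have [|-> _ -> ->] := @wt_tab (w o0) (w o3); first by rewrite (inj_eq perm_inj).
by have [|_ -> -> ->] := @wt_tab (w o1) (w o2); first by rewrite (inj_eq perm_inj).
Qed.

Lemma weight_psi2_coef :
  \sum_(w : 'S_4) (-1) ^+ odd_perm w *
    weight_psi2 ((beta (part l) (w o0))%:Z - (beta (part l) (w o1))%:Z)
           (beta (part l) (w o3)) =
  4 * (coef_of false - coef_of true).
Proof.
have [g1 g2 g3] := part_gaps.
rewrite /coef_of !addFb !addTb -(sum_tab_psi2 g1 g2 g3 part_parity).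
apply: eq_bigr => w _; congr (_ * _); rewrite /weight_psi2 /tab_psi2 -signr_odd beta_parity.
by have [|-> _ _ _] := @wt_tab (w o0) (w o1); first by rewrite (inj_eq perm_inj).
Qed.
End Parts.

Section Final.
Variables (k n : nat).
Hypotheses (hk : (0 < k)%N) (hn : n = (2 * k)%N).

Let even_n : ~~ odd n. Proof. by rewrite hn mul2n odd_double. Qed.

(** The value of chi^2 is the sum of the values of the symmetric and the
    alternating square, that of chi at g^2 their difference. *)
Lemma two_row_sq_expansion (g : 'S_n) :
  jt_char (two_row k) g ^+ 2 =
  \sum_(l in P4 n) (coef_of l false + coef_of l true) * jt_char (part l) g.
Proof.
apply: (@mulfI _ (4 : int)) => //; rewrite (two_row_sq _ hk hn).
pose G (x : 'I_4 -> nat) := weight_sq ((x o0)%:Z - (x o3)%:Z) ((x o1)%:Z - (x o2)%:Z).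
have GE x y : x =1 y -> G x = G y by move=> xy; rewrite /G !xy.
transitivity (\sum_(f : {ffun 'I_n -> 'I_4} | fixes g f) \sum_(w : 'S_4)
     (-1) ^+ odd_perm w * G (fun i => content f i + rev_ord (w i))%N).
  apply: eq_bigr => f _; rewrite -antisym_weight_sq; apply: eq_bigr => w _; congr (_ * _).
  rewrite /G; move: (content f) => c /=.
  have := ltn_ord (w o0); have := ltn_ord (w o1); have := ltn_ord (w o2); have := ltn_ord (w o3).
  by move=> *; congr weight_sq; lia.
rewrite (sum_fixes_antisym _ GE) mulr_sumr; apply: eq_bigr => l lP.
by rewrite mulrA -weight_sq_coef.
Qed.

Lemma two_row_psi2_expansion (g : 'S_n) :
  jt_char (two_row k) (g * g)%g =
  \sum_(l in P4 n) (coef_of l false - coef_of l true) * jt_char (part l) g.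
Proof.
apply: (@mulfI _ (4 : int)) => //.
rewrite (_ : 4 * _ = 2 * (2 * jt_char (two_row k) (g * g)%g)); last by ring.
rewrite (two_row_psi2 _ hk hn).
pose G (x : 'I_4 -> nat) := weight_psi2 ((x o0)%:Z - (x o1)%:Z) (x o3).
have GE x y : x =1 y -> G x = G y by move=> xy; rewrite /G !xy.
transitivity (\sum_(f : {ffun 'I_n -> 'I_4} | fixes g f) \sum_(w : 'S_4)
     (-1) ^+ odd_perm w * G (fun i => content f i + rev_ord (w i))%N).
  rewrite mulr_sumr; apply: eq_bigr => f _; rewrite -antisym_weight_psi2.
  apply: eq_bigr => w _; congr (_ * _).
  rewrite /G; move: (content f) => c /=.
  have := ltn_ord (w o0); have := ltn_ord (w o1); have := ltn_ord (w o3).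
  by move=> *; congr weight_psi2; lia.
rewrite (sum_fixes_antisym _ GE) mulr_sumr; apply: eq_bigr => l lP.
by rewrite mulrA -weight_psi2_coef.
Qed.

Lemma symm_char_part (l : 4.-tuple 'I_n.+1) g : l \in P4 n ->
  symm_char n (parts l) g = (jt_char (part l) g)%:~R.
Proof.
rewrite inE => /andP [sl /eqP suml].
by rewrite (@symm_charE n 4) // size_map size_tuple.
Qed.

Lemma symm_char_two_row g : symm_char n [:: k + 1; k - 1]%N g = (jt_char (two_row k) g)%:~R.
Proof. by rewrite (@symm_charE n 2) //= ?hn; lia. Qed.
End Final.

Lemma sub_P4 n (A : {set 4.-tuple 'I_n.+1}) (F : 4.-tuple 'I_n.+1 -> algC) :
  A \subset P4 n -> \sum_(l in A) F l = \sum_(l in P4 n) (l \in A)%:R * F l.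
Proof.
move=> /setIidPr {1}<-; rewrite [RHS](bigID (mem A)) /= [X in _ + X]big1 ?addr0.
  by apply: eq_big => l; [rewrite inE | rewrite inE => /andP [_ ->]; rewrite mul1r].
by move=> l /andP [_ /negbTE ->]; rewrite mul0r.
Qed.

Theorem theorem7p13 (k n : nat) (hk : (1 <= k)%N) (hn : n = (2 * k)%N) :
  symm_square (symm_char n [:: k + 1; k - 1]%N) =
    \sum_(l in E4 n) ((ndistinct l)%:R - 1) *: symm_char n (parts l)
    + \sum_(l in E2O2' n) symm_char n (parts l)
  /\
  alt_square (symm_char n [:: k + 1; k - 1]%N) =
    \sum_(l in O4 n) ((ndistinct l)%:R - 1) *: symm_char n (parts l)
    + \sum_(l in E2'O2 n) symm_char n (parts l).
Proof.
have sub (A : {set 4.-tuple 'I_n.+1}) Q : A = [set l in P4 n | Q l] -> A \subset P4 n.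
  by move=> ->; apply/subsetP => l; rewrite inE => /andP [].
have RHS (A B : {set 4.-tuple 'I_n.+1}) (s : bool) g :
    A \subset P4 n -> B \subset P4 n ->
    (forall l, l \in P4 n -> coef_of l s = (l \in A)%:R * ((ndistinct l)%:R - 1) + (l \in B)%:R) ->
    (\sum_(l in A) ((ndistinct l)%:R - 1) *: symm_char n (parts l)
      + \sum_(l in B) symm_char n (parts l)) g
    = (\sum_(l in P4 n) coef_of l s * jt_char (part l) g)%:~R.
  move=> sA sB cE; rewrite cfunE !sum_cfunE.
  under eq_bigr do rewrite cfunE.
  rewrite (sub_P4 _ sA) (sub_P4 _ sB) -big_split intr_sum.
  apply: eq_bigr => l lP; rewrite (symm_char_part _ lP) cE // /=.
  rewrite rmorphM rmorphD rmorphM rmorphB !rmorph_nat rmorph1.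
  by rewrite [RHS]mulrDl -mulrA.
have sq g := two_row_sq_expansion hk hn g; have sqr g := two_row_psi2_expansion hk hn g.
split; apply/cfunP => g.
  rewrite symm_squareE ?inE // !(symm_char_two_row hk hn) expg2.
  rewrite (RHS _ _ false); [|exact: sub|exact: sub|exact: coef_even].
  rewrite -rmorphXn -rmorphD /= sq sqr -big_split /=.
  rewrite (eq_bigr (fun l => 2 * (coef_of l false * jt_char (part l) g))) => [|l _]; last by ring.
  by rewrite -mulr_sumr rmorphM mulKf ?pnatr_eq0.
rewrite alt_squareE ?inE // !(symm_char_two_row hk hn) expg2.
rewrite (RHS _ _ true); [|exact: sub|exact: sub|exact: coef_odd].
rewrite -rmorphXn -rmorphB /= sq sqr -sumrB /=.
rewrite (eq_bigr (fun l => 2 * (coef_of l true * jt_char (part l) g))) => [|l _]; last by ring.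
by rewrite -mulr_sumr rmorphM mulKf ?pnatr_eq0.
Qed.
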